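(* There exist non-trivial rigid pairs in each of the following symmetric Lie algebras $(\mathfrak g,\mathfrak k)$: \begin{itemize} \item $(\mathfrak{sl}_{p+1},\mathfrak{sl}_p\oplus\mathfrak t_1)$ (type AIII), for every $p\geqslant2$; \item $(\mathfrak{sp}_{2p+2},\mathfrak{sp}_{2p}\oplus\mathfrak{sp}_2)$ (type CII), for every $p\geqslant 2$; \item $(\mathfrak{sp}_{12},\mathfrak{sp}_6\oplus\mathfrak{sp}_6)$ (type CII); \item $(\mathfrak{so}_{12},\mathfrak{gl}_6)$ (type DIII); \item $(\mathfrak e_7,\mathfrak e_6\oplus\mathfrak t_1)$ (type EVII); \item $(\mathfrak f_4,\mathfrak{so}_9)$ (type FII). \end{itemize}
   Context: $\Bbbk$ is an algebraically closed field of characteristic $0$. A symmetric Lie algebra $(\mathfrak g,\mathfrak k)$ is a finite-dimensional reductive Lie algebra $\mathfrak g$ over $\Bbbk$ with an involution $\theta$; $\mathfrak k$ and $\mathfrak p$ are the $+1$ and $-1$ eigenspaces of $\theta$. The listed pairs are the standard ones in Cartan's classification (Helgason), up to isomorphism; $\mathfrak{sp}_{2n}$ acts on $\Bbbk^{2n}$, and $\mathfrak t_1$ is a one-dimensional toral subalgebra. A Cartan subspace is a maximal toral subalgebra (all elements semisimple) contained in $\mathfrak p$; all have the same dimension $\mathrm{rk}_{sym}(\mathfrak g,\mathfrak k)$. Fix a Cartan subspace $\mathfrak a$ and let $\mathfrak m$ be the centralizer of $\mathfrak a$ in $\mathfrak k$. For $x,y\in\mathfrak p$ with $[x,y]=0$,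 let $\mathfrak k^{x,y}=\{k\in\mathfrak k\mid[k,x]=[k,y]=0\}$ and $i((\mathfrak g,\mathfrak k),(x,y))=\dim\mathfrak k^{x,y}-\dim\mathfrak m$. The commuting pair $(x,y)$ is rigid if $i((\mathfrak g,\mathfrak k),(x,y))=-\mathrm{rk}_{sym}(\mathfrak g,\mathfrak k)$. The rigid pair $(0,0)$ occurring when $\mathfrak p=\{0\}$ is called trivial; other rigid pairs are non-trivial. *)

(* Defs.v *)
From HB Require Import structures.
From Stdlib Require Import Classical.
From mathcomp Require Import all_boot all_order all_algebra.

Set Implicit Arguments.
Unset Strict Implicit.
Unset Printing Implicit Defensive.

Import GRing.Theory.
Local Open Scope ring_scope.

(* Finite-dimensional reductive Lie algebras with an involution.  The bracket
   is given through the adjoint map, [x, y] = ad x y, so that bilinearity is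
   carried by the type of [ad]; "reductive" means that the adjoint
   representation is semisimple.  The identity is allowed as an involution
   (then p = 0). *)
Definition is_ideal (K : fieldType) (V : vectType K) (ad : 'Hom(V, 'End(V)))
    (I : {vspace V}) : Prop :=
  forall x y, y \in I -> ad x y \in I.

Record symLieAlg (K : fieldType) := SymLieAlg {
  carrier :> vectType K;
  ad : 'Hom(carrier, 'End(carrier));
  theta : 'End(carrier);
  lie_alt : forall x, ad x x = 0;
  lie_jacobi : forall x y z,
    ad x (ad y z) + ad y (ad z x) + ad z (ad x y) = 0;
  lie_reductive : forall I : {vspace carrier}, is_ideal ad I ->
    exists J : {vspace carrier},
      [/\ is_ideal ad J, (I + J)%VS = fullv & (I :&: J)%VS = 0%VS];
  theta_lie : forall x y, theta (ad x y) = ad (theta x) (theta y);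
  theta_invol : forall x, theta (theta x) = x
}.

Section SymmetricLieAlgebra.
Variables (K : fieldType) (S : symLieAlg K).
Implicit Types (x y : S) (a : {vspace S}).

Definition lie x y : S := ad S x y.

Definition kk : {vspace S} := passmx.leigenspace (theta S) 1.
Definition pp : {vspace S} := passmx.leigenspace (theta S) (-1).

Definition semisimple_elt x : Prop :=
  exists X : seq S, basis_of fullv X /\
    forall v, v \in X -> exists c : K, lie x v = c *: v.

Definition is_toral a : Prop :=
  (forall x y, x \in a -> y \in a -> lie x y \in a) /\
  (forall x, x \in a -> semisimple_elt x).

Definition is_Cartan_subspace a : Prop :=
  [/\ is_toral a, (a <= pp)%VS &
      forall b : {vspace S}, is_toral b -> (b <= pp)%VS ->
        (a <= b)%VS -> b = a].

(* The centralizer of a in k; by linearity it suffices to commute with a basis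
   of a. *)
Definition mm a : {vspace S} :=
  (kk :&: \bigcap_(u <- vbasis a) lker (ad S u))%VS.

Definition kk_cent x y : {vspace S} :=
  (kk :&: lker (ad S x) :&: lker (ad S y))%VS.

Definition pair_index a x y : int := (\dim (kk_cent x y))%:Z - (\dim (mm a))%:Z.

(* All Cartan subspaces are conjugate, so \dim a is the symmetric rank and
   nothing depends on the choice of a; they exist by
   [Cartan_subspace_exists] below. *)
Definition is_rigid x y : Prop :=
  [/\ x \in pp, y \in pp, lie x y = 0 &
      forall a, is_Cartan_subspace a -> pair_index a x y = - (\dim a)%:Z].

Definition is_trivial_pair x y : Prop := [/\ pp = 0%VS, x = 0 & y = 0].

Definition has_nontrivial_rigid_pair : Prop :=
  exists x y, is_rigid x y /\ ~ is_trivial_pair x y.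

Lemma Cartan_subspace_exists : exists a, is_Cartan_subspace a.
Proof.
have tor0 : is_toral 0%VS.
  split=> [x y|x]; rewrite memv0 => /eqP->.
    by rewrite /lie linear0 lfunE mem0v.
  exists (vbasis fullv); split; first exact: vbasisP.
  by move=> v _; exists 0; rewrite /lie linear0 lfunE scale0r.
suff main n a : is_toral a -> (a <= pp)%VS -> (\dim {:S} - \dim a < n)%N ->
    exists b, is_Cartan_subspace b.
  by apply: (main _ _ tor0 (sub0v _)); apply: ltnSn.
elim: n a => // n IHn a tora sap lt_n.
have [Ca|nCa] := classic (is_Cartan_subspace a); first by exists a.
have [b [torb sbp sab neq]] : exists b : {vspace S},
    [/\ is_toral b, (b <= pp)%VS, (a <= b)%VS & b <> a].
  apply: NNPP => nb; apply: nCa; split=> // b torb sbp sab.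
  by apply: NNPP => neq; apply: nb; exists b.
apply: (IHn b torb sbp).
have lt_ab : (\dim a < \dim b)%N.
  rewrite ltn_neqAle dimvS // andbT; apply/eqP => eq_dim.
  by apply: neq; apply/esym/eqP; rewrite eqEdim sab eq_dim leqnn.
have le_b : (\dim b <= \dim {:S})%N by apply/dimvS/subvf.
by rewrite ltnS in lt_n; apply: leq_trans lt_n; apply: ltn_sub2l => //;
  apply: leq_trans le_b.
Qed.

End SymmetricLieAlgebra.

(* A concrete model of a symmetric Lie algebra: the elements of [amb]
   satisfying [mem], with bracket [mbr] and involution [mtheta]. *)
Record pairModel (K : fieldType) := PairModel {
  amb : vectType K;
  mem_model : amb -> Prop;
  mbr : amb -> amb -> amb;
  mtheta : amb -> amb
}.

Definition isomorphic_to (K : fieldType) (S : symLieAlg K) (M : pairModel K) :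
    Prop :=
  exists f : 'Hom(S, amb M),
    [/\ injective f,
        forall v, mem_model v <-> exists x, f x = v,
        forall x y, f (lie x y) = mbr (f x) (f y) &
        forall x, f (theta S x) = mtheta (f x)].

(* Classical models: matrices with the commutator, the involution being
   conjugation by a diagonal matrix s of signs (s^-1 = s), so that k consists
   of the block-diagonal elements. *)
Section Classical.
Variable K : fieldType.

Definition sign_mx (m n : nat) : 'M[K]_(m + n) := block_mx 1%:M 0 0 (- 1%:M).

Definition mx_pair (n : nat) (P : 'M[K]_n -> Prop) (s : 'M[K]_n) :
    pairModel K :=
  @PairModel K 'M[K]_n P (fun A B => A *m B - B *m A) (fun A => s *m A *m s).

(* sl_(p+q), with k = s(gl_p + gl_q), which is sl_p + t_1 for q = 1 *)
Definition AIII (p q : nat) : pairModel K :=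
  @mx_pair (p + q) (fun A => \tr A = 0) (sign_mx p q).

Definition symplectic_form (m : nat) : 'M[K]_(m + m) :=
  block_mx 0 1%:M (- 1%:M) 0.

(* sp_(2p+2q), for the orthogonal sum of the standard symplectic forms on
   K^2p and K^2q, with k = sp_2p + sp_2q *)
Definition CII (p q : nat) : pairModel K :=
  let J := block_mx (symplectic_form p) 0 0 (symplectic_form q) in
  @mx_pair ((p + p) + (q + q)) (fun A => A^T *m J + J *m A = 0)
    (sign_mx (p + p) (q + q)).

(* so_2n, for the split quadratic form, with k = {diag(B, - B^T)} = gl_n *)
Definition DIII (n : nat) : pairModel K :=
  let Q : 'M[K]_(n + n) := block_mx 0 1%:M 1%:M 0 in
  @mx_pair (n + n) (fun A => A^T *m Q + Q *m A = 0) (sign_mx n n).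

End Classical.

(* The simple Lie algebra of a simply laced Dynkin diagram, constructed from
   its root lattice as in Kac, Infinite dimensional Lie algebras, 7.8.  The
   diagram has nodes 0, ..., n-1 and is given by the list of its edges, with an
   arbitrary orientation.  A lattice vector is the list of its n coordinates in
   the basis of simple roots. *)
Section SimplyLaced.
Variables (n : nat) (edges : seq (nat * nat)).
Implicit Types a b : seq int.

Definition lat_add a b : seq int := mkseq (fun i => a`_i + b`_i) n.
Definition lat_zero : seq int := nseq n 0.
Definition simple_root (i : nat) : seq int :=
  mkseq (fun j => (i == j)%:R : int) n.

Definition euler_form a b : int :=
  \sum_(i < n) a`_i * b`_i - \sum_(e <- edges) a`_e.1 * b`_e.2.
Definition root_form a b : int := euler_form a b + euler_form b a.

Definition reflection (i : nat) a : seq int :=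
  mkseq (fun j => a`_j - root_form a (simple_root i) * (i == j)%:R) n.

(* The roots form the orbit of the simple roots under the simple reflections.
   For E6 and E7 it is reached after 11, resp. 17 steps (the height of the
   highest root), hence after 20. *)
Definition root_step (r : seq (seq int)) : seq (seq int) :=
  undup (r ++ [seq reflection i a | a <- r, i <- iota 0 n]).
Definition roots : seq (seq int) :=
  iter 20 root_step [seq simple_root i | i <- iota 0 n].

Definition root_idx : Type := seq_sub roots.

Variable K : fieldType.

(* (h, c) stands for \sum_i h_i alpha_i + \sum_a c_a e_a, where the Cartan
   subalgebra is the scalar extension of the root lattice. *)
Definition slaced_space : vectType K :=
  ('rV[K]_n * {ffun root_idx -> K^o})%type.

Definition cartan_pairing (h : 'rV[K]_n) b : K :=
  \sum_(i < n) h 0 i * (root_form (simple_root i) b)%:~R.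

Definition asym (a b : seq int) : K := (-1) ^ euler_form a b.

(* [h, e_b] = (h | b) e_b,  [e_a, e_-a] = - a  and
   [e_a, e_b] = asym a b *: e_(a + b) if a + b is a root. *)
Definition slaced_bracket (u v : slaced_space) : slaced_space :=
  (\row_i - \sum_(a : root_idx) \sum_(b : root_idx |
        lat_add (val a) (val b) == lat_zero)
      u.2 a * v.2 b * ((val a)`_i)%:~R,
   [ffun c : root_idx =>
      cartan_pairing u.1 (val c) * v.2 c - cartan_pairing v.1 (val c) * u.2 c
      + \sum_(a : root_idx) \sum_(b : root_idx |
            lat_add (val a) (val b) == val c)
          asym (val a) (val b) * u.2 a * v.2 b]).

(* The inner involution acting on e_a by (-1) ^ t(a), where t(a) is the sum of
   the coordinates of a at the given nodes. *)
Definition parity_involution (nodes : seq nat) (u : slaced_space) : slaced_space :=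
  (u.1, [ffun c : root_idx => (-1) ^ (\sum_(i <- nodes) (val c)`_i) * u.2 c]).

End SimplyLaced.

Section Exceptional.
Variable K : fieldType.

(* Nodes 0, ..., 5 (resp. 6) are nodes 1, ..., 6 (resp. 7) of Bourbaki; the
   orientation of E6 is invariant under the diagram automorphism. *)
Definition E6_edges : seq (nat * nat) :=
  [:: (0, 2); (2, 3); (1, 3); (4, 3); (5, 4)]%N.
Definition E7_edges : seq (nat * nat) := (6, 5)%N :: E6_edges.

(* The last node of E7 has coefficient 1 in the highest root, so the even part
   for the parity at this node is k = e_6 + t_1, of dimension 79, where e_6 is
   spanned by the root system on the other nodes. *)
Definition EVII : pairModel K :=
  @PairModel K (slaced_space 7 E7_edges K) (fun=> True)
    (@slaced_bracket 7 E7_edges K) (@parity_involution 7 E7_edges K [:: 6%N]).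

Definition E6_flip (i : nat) : nat := nth 0%N [:: 5; 1; 4; 3; 2; 0]%N i.

Definition flip_fixed (u : slaced_space 6 E6_edges K) : Prop :=
  (forall i j : 'I_6, j = E6_flip i :> nat -> u.1 0 j = u.1 0 i) /\
  (forall a b : root_idx 6 E6_edges,
     val b = mkseq (fun i => (val a)`_(E6_flip i)) 6 -> u.2 b = u.2 a).

(* f_4 is the fixed point algebra of the diagram automorphism
   alpha_i |-> alpha_(E6_flip i), e_a |-> e_(E6_flip a) of e_6.  The end nodes
   0 and 5 fold to the short end node of the F4 diagram, which has coefficient
   2 in the highest root of F4; deleting it from the extended diagram of F4
   leaves a diagram of type B4, so the even part is k = so_9, of dimension
   36. *)
Definition FII : pairModel K :=
  @PairModel K (slaced_space 6 E6_edges K) flip_fixed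
    (@slaced_bracket 6 E6_edges K)
    (@parity_involution 6 E6_edges K [:: 0; 5]%N).

End Exceptional.

(* Main.v *)
From HB Require Import structures.
From Stdlib Require Import Classical ClassicalEpsilon.
Require Import Defs.
From mathcomp Require Import all_boot all_order all_algebra zify.
Set Implicit Arguments.
Unset Strict Implicit.
Unset Printing Implicit Defensive.
Import GRing.Theory passmx.
Local Open Scope ring_scope.

(** The index of a commuting pair is measured against a Cartan subspace a, but for every a [dim
    k - dim m = dim p - dim a] (lemma [cartan_dim]), so a pair (x, y) is rigid if and only if
    its centralizer in k has dimension [dim k - dim p].

    The equality of dimensions follows from the fact that a is its own centralizer in p
    ([cartan_self_centralizing]), since a semisimple element of p exchanges k and p with equal
    ranks. That fact is classical for reductive algebras, and it rests on the Killing form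
    having the center as its radical ([killing_radical_center], from Cartan's criterion and
    Engel's theorem), on derivations that kill the center being inner ([derivation_inner]), and
    on the Jordan decomposition inside p that this provides ([jordan_ad]).

    The centralizer of a commuting pair in k always has dimension at least [dim k - dim p]: by
    invariance of the Killing form ad x has at most the same rank on k as on p, and ad y maps
    the kernel of ad x in k into its kernel in p ([dim_kk_cent]). So a pair is rigid as soon as
    k contains a subspace of dimension [dim p] that meets its centralizer trivially. Such a
    subspace is given as the image of a linear map Phi from p to k, for which one has to see
    that v = 0 if Phi v commutes with x and y ([rigid_criterion], and [model_criterion] for a
    concrete model).

    It remains to exhibit x, y and Phi. For the two infinite families x and y are two
    independent vectors, basic columns for AIII and vectors of a Lagrangian subspace for CII,
    and the verification is a block matrix computation ([AIII_rigid], [CII_1_rigid]). In so(12)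
    and e(7) the pair is the multiplication by s and t on the algebra K[s, t] / (s, t)^3 of
    dimension 6, embedded through gl(6) in so(12) and through a subsystem of type A5 in e(7); in
    sp(12) it is the multiplication by s and t on a 12-dimensional self-dual module with layers
    of dimension 3, 6, 3; in f(4), the fixed points of the diagram automorphism of e(6), it
    consists of two short root vectors. In these four cases Phi maps coordinates of p to matrix
    entries, resp. to root vectors and toral basis elements, in such a way that the equations
    can be solved one unknown at a time with nonzero integral coefficients. This is verified by
    computation, with coefficients in the integers ([certificate_rigid],
    [root_certificate_rigid], [fixed_root_certificate_rigid]), and holds over every field of
    characteristic 0. *)

(** * Traces of endomorphisms *)

Section Trace.
Variables (K : fieldType) (V : vectType K).
Implicit Types f g : 'End(V).

Definition lfun_trace f : K^o := \tr (mxof (vbasis {:V}) (vbasis {:V}) f).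

Lemma lfun_trace_is_linear : linear lfun_trace.
Proof. by move=> c f g; rewrite /lfun_trace linearP mxtraceD mxtraceZ. Qed.
HB.instance Definition _ := GRing.isLinear.Build K 'End(V) K^o _ lfun_trace lfun_trace_is_linear.

Lemma lfun_trace_comp f g : lfun_trace (f \o g)%VF = lfun_trace (g \o f)%VF.
Proof. by rewrite /lfun_trace !(mxof_comp _ _ (vbasisP _)) mxtrace_mulC. Qed.

Definition nilpotent_lfun f : Prop := exists k, forall v, iter k f v = 0.

(** Factoring a singular A as C *m R through a smaller space, the trace of A is that of R *m C,
    which is again nilpotent: induction on the size. *)
Lemma mxtrace_nilpotent n (A : 'M[K]_n) k : iter k (mulmx A) 1%:M = 0 -> \tr A = 0.
Proof.
elim/ltn_ind: n A k => n IHn A k Ak0.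
have [rA|] := ltnP (\rank A) n; last first.
  (* an invertible matrix is nilpotent in dimension 0 only *)
  move=> rn; have uA : A \in unitmx by rewrite -row_full_unit /row_full eqn_leq rank_leq_row.
  have u1 : 1%:M = 0 :> 'M[K]_n.
    elim: k Ak0 => //= k IHk Ak0; apply: IHk.
    by rewrite -(mulKmx uA (iter k _ _)) Ak0 mulmx0.
  by rewrite -[A]mul1mx u1 mul0mx mxtrace0.
have [r [C [R [rn AE]]]] : exists r (C : 'M[K]_(n, r)) (R : 'M[K]_(r, n)),
    (r < n)%N /\ A = C *m R.
  by exists (\rank A), (col_base A), (row_base A); rewrite mulmx_base.
rewrite AE mxtrace_mulC; apply: (IHn _ rn _ k.+1).
have iterE j : iter j.+1 (mulmx (R *m C)) 1%:M = R *m (iter j (mulmx A) 1%:M) *m C.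
  elim: j => [|j IHj]; first by rewrite /= !mulmx1.
  by rewrite iterS IHj iterS AE !mulmxA.
by rewrite iterE Ak0 mulmx0 mul0mx.
Qed.

Lemma lfun_trace_nilpotent f : nilpotent_lfun f -> lfun_trace f = 0.
Proof.
case=> k fk0; apply: (@mxtrace_nilpotent _ _ k).
pose e := vbasis {:V}; set A := mxof _ _ _.
have eb : basis_of {:V} e by apply: vbasisP.
apply/row_matrixP => i; rewrite row0 rowE.
have [u ->] : exists u, delta_mx 0 i = rVof e u.
  by exists (vecof e (delta_mx 0 i)); rewrite vecofK.
have -> j : rVof e u *m iter j (mulmx A) 1%:M = rVof e (iter j f u).
  elim: j u => [|j IHj] u; first by rewrite mulmx1.
  by rewrite iterS mulmxA -(rVof_app _ eb) IHj iterSr.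
by rewrite fk0 linear0.
Qed.

(** The trace of a projection is its rank, which in characteristic 0 can only vanish with the
    projection. *)
Lemma lfun_trace_idempotent f : (f \o f)%VF = f -> exists m : nat, lfun_trace f = m%:R /\
  (m = 0%N -> f = 0).
Proof.
have eb := vbasisP {:V}.
move=> /(congr1 (mxof (vbasis _) (vbasis _))).
rewrite (mxof_comp _ _ eb); set A := mxof _ _ _ => AA.
exists (\rank A); split; last first.
  move/eqP; rewrite mxrank_eq0 => /eqP A0; apply/eqP.
  by rewrite -(mxof_eq0 eb eb) -/A A0.
rewrite /lfun_trace -/A.
have := mulmx_base A; have [C' ] := row_fullP (col_base_full A).
have [R' ] := row_freeP (row_base_free A).
move: (col_base A) (row_base A) => C R RR' C'C CRA.
rewrite -{1}CRA mxtrace_mulC; suff -> : R *m C = 1%:M by rewrite mxtrace1.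
have CRCR : C *m (R *m C) *m R = C *m R by rewrite -!mulmxA (mulmxA C) CRA AA.
rewrite -[LHS]mul1mx -C'C -[LHS]mulmx1 -RR' mulmxA -(mulmxA C') -(mulmxA C').
by rewrite CRCR mulmxA C'C mul1mx.
Qed.

End Trace.

(** * Diagonalizable endomorphisms and spectral projections *)

Section Diag.
Variables (K : fieldType) (V : vectType K).
Implicit Types f g : 'End(V).

Definition diag_lfun f : Prop :=
  exists X : seq V, basis_of fullv X /\ forall v, v \in X -> exists c, f v = c *: v.

Lemma free_subset (X : seq V) : exists Y, [/\ {subset Y <= X}, free Y & <<Y>>%VS = <<X>>%VS].
Proof.
elim: X => [|x X [Y [sYX fY eYX]]]; first by exists [::]; rewrite nil_free.
have [xY|xY] := boolP (x \in <<Y>>%VS).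
  exists Y; split=> // [y yY|]; first by rewrite inE sYX ?orbT.
  by rewrite span_cons -eYX; apply/esym/addv_idPr; rewrite -memvE.
exists (x :: Y); rewrite free_cons xY fY !span_cons eYX; split=> // y.
by rewrite !inE => /orP[->//|/sYX->]; rewrite orbT.
Qed.

Lemma diag_lfun_span f (X : seq V) : <<X>>%VS = fullv ->
  (forall v, v \in X -> exists c, f v = c *: v) -> diag_lfun f.
Proof.
move=> sX eX; have [Y [sYX fY eYX]] := free_subset X.
exists Y; split; last by move=> v /sYX /eX.
by rewrite basisEdim eYX sX subvv /= -sX -eYX; move: fY; rewrite /free => /eqP->.
Qed.

Lemma shiftE f (a : K) v : (f - a *: \1)%VF v = f v - a *: v.
Proof. by rewrite add_lfunE opp_lfunE scale_lfunE id_lfunE. Qed.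

Lemma diag_lfun_shift f (a : K) : diag_lfun f -> diag_lfun (f - a *: \1)%VF.
Proof.
case=> X [bX eX]; exists X; split=> // v /eX[c fv]; exists (c - a).
by rewrite shiftE fv scalerBl.
Qed.

Lemma diag_lfun_ker2 f v : diag_lfun f -> f (f v) = 0 -> f v = 0.
Proof.
case=> X [bX eX].
pose t : (size X).-tuple V := in_tuple X.
have bt : basis_of fullv t by [].
have /fin_all_exists [c fc] : forall i : 'I_(size X), exists c, f t`_i = c *: t`_i.
  by move=> i; apply: eX; apply: mem_nth.
rewrite (coord_basis bt (memvf v)) !linear_sum /=.
under eq_bigr do rewrite !linearZ /= fc linearZ /= fc !scalerA.
under [X in _ -> X = 0]eq_bigr do rewrite linearZ /= fc scalerA.
have /freeP ft := basis_free bt; move=> /ft ff; apply: big1 => i _.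
have /eqP := ff i; rewrite -mulrA !mulf_eq0 orbb => /orP[]/eqP->; by rewrite ?mul0r ?mulr0 scale0r.
Qed.

Lemma diag_lfun_ker_iter f k v : diag_lfun f -> iter k f v = 0 -> (0 < k)%N -> f v = 0.
Proof.
move=> df; case: k => // k fk _; elim: k fk => // k IHk fk.
by apply: IHk; apply: diag_lfun_ker2.
Qed.

Definition gen_eigen f (a : K) v := exists k, iter k (f - a *: \1)%VF v = 0.

Lemma lfun_iter0 f k : iter k f 0 = 0.
Proof. by elim: k => //= k ->; rewrite linear0. Qed.

Lemma diag_lfun_gen_eigen f a v : diag_lfun f -> gen_eigen f a v -> f v = a *: v.
Proof.
move=> df [k fk]; apply/eqP; rewrite -subr_eq0; apply/eqP.
have := @diag_lfun_ker_iter _ k.+1 v (diag_lfun_shift a df).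
by rewrite /= fk linear0 shiftE; apply.
Qed.

Lemma iter_comm (f g : 'End(V)) k v :
  (forall u, g (f u) = f (g u)) -> g (iter k f v) = iter k f (g v).
Proof. by move=> fg; elim: k => //= k <-. Qed.

Lemma gen_eigen_disjoint f a b v : a != b -> gen_eigen f a v -> gen_eigen f b v -> v = 0.
Proof.
move=> nab [k]; elim: k v => [//|k IHk] v; rewrite iterSr => fk [l fl].
have fv : (f - a *: \1)%VF v = 0.
  apply: IHk => //; exists l; rewrite -iter_comm ?fl ?linear0 // => u.
  rewrite !shiftE !scalerBr !opprB !linearB !linearZ /= !scalerA mulrC.
  by rewrite addrACA [RHS]addrACA; congr (_ + _); rewrite addrC.
have {fl} : (a - b) ^+ l *: v = 0.
  rewrite -fl; elim: l {fl} => [|l IHl]; first by rewrite scale1r.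
  rewrite iterS -IHl linearZ /= exprS mulrC -scalerA; congr (_ *: _).
  move/eqP: fv; rewrite !shiftE subr_eq0 => /eqP->.
  by rewrite scalerBl.
by move/eqP; rewrite scaler_eq0 expf_eq0 subr_eq0 (negPf nab) andbF => /eqP.
Qed.

End Diag.

Section Spectral.
Variables (K : closedFieldType).

(** Bezout identities between the pairwise coprime factors of the characteristic polynomial
    produce polynomials in A that act as the projections onto the generalized eigenspaces. *)
Lemma spectral_polys n (A : 'M[K]_n.+1) :
  exists (s : seq K) (p : K -> {poly K}) (N : nat),
  [/\ uniq s, \sum_(a <- s) horner_mx A (p a) = 1 &
      forall a, a \in s -> horner_mx A (('X - a%:P) ^+ N * p a) = 0].
Proof.
have [r] := closed_field_poly_normal (char_poly A).
rewrite (monicP (char_poly_monic A)) scale1r => chiE.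
pose s := undup r; pose N := size r.
pose Q (t : seq K) : {poly K} := \prod_(a <- t) ('X - a%:P) ^+ N.
have chiQ : char_poly A %| Q s.
  rewrite chiE /Q -(prodr_undup_exp_count r predT) -/s.
  elim/big_ind2: _ => // [p1 q1 p2 q2 d1 d2|a _]; first exact: dvdp_mul.
  by apply: dvdp_exp2l; apply: count_size.
have Q0 q : Q s %| q -> horner_mx A q = 0.
  move=> /(dvdp_trans chiQ)/dvdpP[q' ->].
  by rewrite rmorphM /= Cayley_Hamilton mulr0.
have us : uniq s by apply: undup_uniq.
have cop a t : a \notin t -> coprimep (('X - a%:P) ^+ N) (Q t).
  move=> at'; rewrite /Q coprimep_expl //; rewrite coprimep_sym.
  elim: t at' => [|b t IHt]; first by rewrite big_nil coprime1p.
  rewrite inE negb_or big_cons => /andP[ab /IHt ct]; rewrite coprimepMl ct andbT.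
  by rewrite coprimep_expl // coprimep_XsubC root_XsubC.
have [w wP] : exists w : K -> {poly K}, forall a, a \in s ->
    exists u, u * ('X - a%:P) ^+ N + w a * Q (rem a s) = 1.
  apply: (choice (fun a w => a \in s -> exists u, u * ('X - a%:P) ^+ N + w * Q (rem a s) = 1)).
  move=> a; have [as_|] := boolP (a \in s); last by exists 0.
  have /cop/Bezout_eq1_coprimepP[[u v] /= uv] : a \notin rem a s by rewrite mem_rem_uniqF.
  by exists v => _; exists u.
pose p a := w a * Q (rem a s).
have Qrem a : a \in s -> Q s = ('X - a%:P) ^+ N * Q (rem a s).
  by move=> as_; rewrite /Q (perm_big _ (perm_to_rem as_)) big_cons.
exists s, p, N; split=> //; last first.
  by move=> a as_; apply: Q0; rewrite (Qrem a as_) /p mulrCA dvdp_mull.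
apply/eqP; rewrite eq_sym -subr_eq0 -(rmorph1 (horner_mx A)) -rmorph_sum -rmorphB /=; apply/eqP/Q0.
have dvdQ q : (forall a, a \in s -> ('X - a%:P) ^+ N %| q) -> Q s %| q.
  elim: s us {chiQ Q0 wP p Qrem} => [|a t IHt]; first by rewrite /Q big_nil dvd1p.
  move=> /= /andP[/cop ct /IHt dt] dq; rewrite /Q big_cons Gauss_dvdp //.
  by rewrite dq ?mem_head // dt // => b bt; rewrite dq // inE bt orbT.
apply: dvdQ => a as_; have [u uw] := wP a as_.
rewrite (bigD1_seq a) //= opprD addrA -{1}uw /p addrK dvdp_sub ?dvdp_mull //.
rewrite big_seq_cond; apply: (big_ind (fun q => _ %| q)); first exact: dvdp0.
  by move=> ? ? ? ?; rewrite dvdp_add.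
move=> b /andP[bs ba]; rewrite dvdp_mull // /Q (perm_big _ (perm_to_rem (_ : a \in rem b s))).
  by rewrite big_cons dvdp_mulr.
by rewrite mem_rem_uniq // inE eq_sym ba.
Qed.

Lemma spectral_mx n (A : 'M[K]_n) :
  exists (s : seq K) (E : K -> 'M[K]_n) (N : nat),
  [/\ uniq s, \sum_(a <- s) E a = 1%:M,
      forall a, a \in s -> iter N (mulmx^~ (A - a%:M)) (E a) = 0 &
      forall B, comm_mx A B -> forall a, comm_mx (E a) B].
Proof.
case: n A => [|n] A.
  exists [::], (fun=> 0), 0%N; split=> // [|B _ a]; first by rewrite big_nil thinmx0.
  by rewrite /comm_mx mul0mx mulmx0.
have [s [p [N [us s1 sN]]]] := spectral_polys A.
exists s, (fun a => horner_mx A (p a)), N; split=> // [a /sN|B AB a]; last first.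
  exact: comm_horner_mx.
rewrite rmorphM rmorphXn rmorphB /= horner_mx_X horner_mx_C => <-.
set D := A - _; set P := horner_mx _ _.
have PD : comm_mx P D.
  by apply: comm_horner_mx; apply: comm_mxB => //; apply: comm_mx_scalar.
rewrite -(commrX N PD : P * D ^+ N = _); elim: N {s1 sN PD} => [|N IHN];
  first by rewrite expr0 mulr1.
by rewrite iterS IHN exprSr -[LHS]/(P * _ * _) mulrA.
Qed.

(** The projections are polynomials in f; what is kept of this is that they commute with
    everything that commutes with f. *)
Lemma spectral_projections (V : vectType K) (f : 'End(V)) :
  exists (s : seq K) (e : K -> 'End(V)),
  [/\ uniq s, (forall v, \sum_(a <- s) e a v = v),
      (forall a v, a \in s -> gen_eigen f a (e a v)) &
      forall g : 'End(V), (forall v, g (f v) = f (g v)) ->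
        forall a v, e a (g v) = g (e a v)].
Proof.
pose B := vbasis {:V}; have eb : basis_of {:V} B by apply: vbasisP.
have [s [E [N [us s1 sN sC]]]] := spectral_mx (mxof B B f).
exists s, (fun a => hommx B B (E a)); split=> //.
- move=> v; rewrite -sum_lfunE -linear_sum /= s1 hommx1 //.
  exact: id_lfunE.
- move=> a v /sN EN; exists N.
  have gE j : iter j (f - a *: \1)%VF (hommx B B (E a) v) =
      hommx B B (iter j (mulmx^~ (mxof B B f - a%:M)) (E a)) v.
    elim: j => //= j ->; rewrite (hommx_mul eb eb eb) comp_lfunE.
    congr (fun_of_lfun _ _); apply: (can_inj (mxofK eb eb)).
    by rewrite hommxK // linearB linearZ /= mxof1 ?(basis_free eb) // scalemx1.
  by rewrite gE EN linear0 zero_lfunE.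
- move=> g gf a v.
  have /sC/(_ a) cE : comm_mx (mxof B B f) (mxof B B g).
    rewrite /comm_mx -!(mxof_comp _ _ eb); congr mxof.
    by apply/lfunP => u; rewrite !comp_lfunE gf.
  have /(congr1 (hommx B B)) := cE.
  rewrite !(hommx_mul eb eb eb) mxofK // => /lfunP/(_ v).
  by rewrite !comp_lfunE.
Qed.

End Spectral.

Section Calculus.
Variables (K : closedFieldType) (V : vectType K).

(** The function [c] is applied to the semisimple part of f: the sum of the [c a *: e a] acts as
    the scalar [c b] on the generalized eigenspace of f for b. With c the identity it is the
    semisimple part itself; other choices of c serve in Cartan's criterion. *)
Lemma jordan_calculus (f : 'End(V)) :
  exists (s : seq K) (e : K -> 'End(V)),
  [/\ uniq s, (forall v, \sum_(a <- s) e a v = v),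
      (forall a v, a \in s -> gen_eigen f a (e a v)),
      (forall (c : K -> K) b v, gen_eigen f b v -> (\sum_(a <- s) c a *: e a) v = c b *: v) &
      forall g : 'End(V), (forall v, g (f v) = f (g v)) ->
        forall a v, e a (g v) = g (e a v)].
Proof.
have [s [e [us s1 sg sC]]] := spectral_projections f.
exists s, e; split=> // c b v vb.
have eC a u : e a (f u) = f (e a u) by apply: sC.
have e0 a : a \in s -> a != b -> e a v = 0.
  move=> as_ ab; apply: (gen_eigen_disjoint ab); first exact: sg.
  have [k vk] := vb; exists k; rewrite -iter_comm ?vk ?linear0 // => u.
  by rewrite !shiftE linearB linearZ /= eC.
rewrite sum_lfunE; under eq_bigr do rewrite scale_lfunE.
rewrite -[in RHS](s1 v) scaler_sumr; apply: eq_big_seq => a as_.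
by have [->//|/(e0 _ as_)->] := eqVneq a b; rewrite !scaler0.
Qed.

End Calculus.

Lemma exists_max (T : Type) (P : T -> Prop) (m : T -> nat) (B : nat) x0 :
  (forall x, P x -> (m x <= B)%N) -> P x0 ->
  exists x, P x /\ forall y, P y -> (m y <= m x)%N.
Proof.
move=> mB.
suff main k x : P x -> (B - m x < k)%N -> exists x, P x /\ forall y, P y -> (m y <= m x)%N.
  by move=> Px0; apply: (main _ x0 Px0 (ltnSn _)).
elim: k x => // k IHk x Px ltk.
have [mx|nx] := classic (forall y, P y -> (m y <= m x)%N); first by exists x.
have [y ny] := not_all_ex_not _ _ nx.
have [Py /negP] := imply_to_and _ _ ny; rewrite -ltnNge => lt.
apply: (IHk y) => //; rewrite ltnS in ltk; apply: leq_trans ltk.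
by rewrite ltn_sub2l // (leq_trans lt) // mB.
Qed.

(** * Rational functionals on scalars *)

Section Char0.
Variable (K : fieldType) (charK0 : [pchar K] =i pred0).

Lemma natr_char0 n : (n%:R == 0 :> K) = (n == 0%N).
Proof. by have /pcharf0P := charK0; apply. Qed.

Lemma intr_char0 (m : int) : (m%:~R == 0 :> K) = (m == 0).
Proof.
case: m => n; rewrite ?NegzE ?mulrNz ?oppr_eq0 -pmulrn natr_char0 //.
Qed.

End Char0.

(** [ratr] with a proof that the characteristic is 0, under which it is a ring morphism even if
    K has no order. *)
Definition rat_to (K : fieldType) (charK0 : [pchar K] =i pred0) : rat -> K := @ratr K.

Section RatTo.
Variable (K : fieldType) (charK0 : [pchar K] =i pred0).

(** That any fraction may be used, reduced or not, is what makes this map additive and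
    multiplicative. *)
Lemma ratr_frac (x : rat) (n d : int) : d != 0 ->
  x * d%:~R = n%:~R -> rat_to charK0 x = n%:~R / d%:~R.
Proof.
move=> d0 xdn; apply/eqP; rewrite eqr_div ?intr_char0 ?denq_neq0 //.
rewrite -!rmorphM /= -subr_eq0 -rmorphB /= intr_char0 // subr_eq0.
by rewrite -(inj_eq (intr_inj : injective (intr : int -> rat))) !rmorphM /= -xdn numqE mulrAC.
Qed.

Lemma rat_to_is_zmod_morphism : zmod_morphism (rat_to charK0).
Proof.
move=> x y.
rewrite (@ratr_frac _ (numq x * denq y - numq y * denq x) (denq x * denq y)).
- rewrite /rat_to /ratr -[X in _ = _ + X]mulNr addf_div ?intr_char0 ?denq_neq0 //.
  by rewrite rmorphB !rmorphM /= mulNr.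
- by rewrite mulf_neq0 ?denq_neq0.
- rewrite rmorphB !rmorphM /= !numqE mulrBl mulrA; congr (_ - _).
  by rewrite -mulrA (mulrC (denq x)%:~R).
Qed.

Lemma rat_to_is_monoid_morphism : monoid_morphism (rat_to charK0).
Proof.
split=> [|x y]; first by rewrite /rat_to /ratr divr1.
rewrite (@ratr_frac _ (numq x * numq y) (denq x * denq y)).
- by rewrite !rmorphM /= -mulf_div.
- by rewrite mulf_neq0 ?denq_neq0.
- by rewrite !rmorphM /= !numqE mulrACA.
Qed.

HB.instance Definition _ := GRing.isZmodMorphism.Build rat K (rat_to charK0)
  rat_to_is_zmod_morphism.
HB.instance Definition _ := GRing.isMonoidMorphism.Build rat K (rat_to charK0)
  rat_to_is_monoid_morphism.

(** A Q-linear form on the span of s over the rationals, not vanishing at a0, given by its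
    values on s. The rational relations between the elements of s form the row space of a matrix
    M. Kernels commute with extension of scalars, so the vector s, which M annihilates, is a
    combination over K of rational vectors annihilated by M; as its entry a0 is not 0, one of
    these vectors has a nonzero entry there. *)
Lemma rational_functional (s : seq K) (a0 : K) : uniq s -> a0 \in s -> a0 != 0 ->
  exists c : K -> rat, c a0 != 0 /\
    forall r : K -> rat, \sum_(a <- s) rat_to charK0 (r a) * a = 0 ->
      \sum_(a <- s) r a * c a = 0.
Proof.
move=> us a0s a00; pose F : {rmorphism rat -> K} := rat_to charK0; pose n := size s.
pose l : 'rV[K]_n := \row_i s`_i.
pose rel m (M : 'M[rat]_(m, n)) := map_mx F M *m l^T = 0.
have [M [relM maxM]] : exists M : 'M_n, rel n M /\ forall M', rel n M' -> (\rank M' <= \rank M)%N.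
  apply: (@exists_max _ _ _ n 0) => [M' _|]; first exact: rank_leq_row.
  by rewrite /rel map_mx0 mul0mx.
have subM (r : 'rV_n) : rel _ r -> (r <= M)%MS.
  move=> relr; have relMr : rel _ (M + r)%MS.
    have /submxP[D ->] : (M + r <= col_mx M r)%MS by rewrite addsmxE.
    by rewrite /rel map_mxM map_col_mx -mulmxA mul_col_mx [map_mx _ M *m _]relM [map_mx _ r *m
      _]relr col_mx0 mulmx0.
  have sMr : (M <= M + r)%MS by apply: addsmxSl.
  have := geq_leqif (mxrank_leqif_sup sMr); rewrite (maxM _ relMr) => /esym.
  by rewrite addsmx_sub => /andP[].
have i0P : (index a0 s < n)%N by rewrite index_mem.
pose i0 := Ordinal i0P.
have [N NM [j Nj]] : exists2 N : 'M[rat]_n, N *m M^T = 0 & exists j, N j i0 != 0.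
  exists (kermx M^T); first exact: mulmx_ker.
  apply: NNPP => nj.
  have /submxP[D lD] : (l <= map_mx F (kermx M^T))%MS.
    rewrite map_kermx; apply/sub_kermxP; apply: trmx_inj.
    by rewrite trmx_mul map_trmx trmxK relM trmx0.
  have := congr1 (fun A : 'rV_n => A 0 i0) lD; rewrite !mxE big1 => [|j _].
    by rewrite /= nth_index // => /eqP; rewrite (negPf a00).
  rewrite (mxE _ _ j i0); have [->|nz] := eqVneq (kermx M^T j i0) 0; first by rewrite rmorph0 mulr0.
  by case: nj; exists j.
pose c a := if insub (index a s) is Some i then N j i else 0.
have cE (i : 'I_n) : c s`_i = N j i.
  by rewrite /c index_uniq // valK.
exists c; split=> [|r]; first by rewrite -[a0](nth_index 0 a0s) (cE i0).
rewrite (big_nth 0) big_mkord => rel0; rewrite (big_nth 0) big_mkord.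
pose v : 'rV[rat]_n := \row_i r s`_i.
have /subM/submxP[D vD] : rel _ v.
  apply/rowP => k; rewrite !mxE -[RHS]rel0; apply: eq_bigr => i _.
  by rewrite !mxE.
have : (row j N *m v^T) 0 0 = 0.
  by rewrite vD trmx_mul mulmxA -row_mul NM row0 mul0mx mxE.
rewrite mxE => rv0; rewrite -[RHS]rv0; apply: eq_bigr => i _.
by rewrite !mxE cE mulrC.
Qed.

End RatTo.

(** * Locally nilpotent endomorphisms *)

Section LocalNil.
Variables (K : fieldType) (V : vectType K).
Implicit Types f g : 'End(V).

Definition loc_nilpotent f v := exists k, iter k f v = 0.

Lemma loc_nilpotentD f u v : loc_nilpotent f u -> loc_nilpotent f v -> loc_nilpotent f (u + v).
Proof.
move=> [k fk] [l fl]; exists (k + l)%N.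
have iter_add j a b : iter j f (a + b) = iter j f a + iter j f b.
  by elim: j => //= j ->; rewrite linearD.
by rewrite iter_add {1}addnC !iterD fk fl !lfun_iter0 addr0.
Qed.

Lemma loc_nilpotent_sum f (I : eqType) (r : seq I) (F : I -> V) :
  (forall i, i \in r -> loc_nilpotent f (F i)) -> loc_nilpotent f (\sum_(i <- r) F i).
Proof.
move=> fF; rewrite big_seq; elim/big_ind: _ => //; first by exists 0%N.
exact: loc_nilpotentD.
Qed.

Lemma nilpotent_of_local f : (forall v, loc_nilpotent f v) -> nilpotent_lfun f.
Proof.
move=> fl; have [k kP] := choice (fun v k => iter k f v = 0) fl.
exists (\sum_(b <- vbasis {:V}) k b)%N => v.
rewrite (coord_vbasis (memvf v)).
have iterS j (I : Type) (r : seq I) (c : I -> K) F :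
    iter j f (\sum_(i <- r) c i *: F i) = \sum_(i <- r) c i *: iter j f (F i).
  elim: j => //= j ->; rewrite linear_sum; apply: eq_bigr => i _.
  by rewrite linearZ.
rewrite iterS big1 // => i _.
have bi : (vbasis {:V})`_i \in (vbasis {:V} : seq V) by rewrite mem_nth ?size_tuple.
rewrite (big_rem _ bi) /= addnC.
by rewrite iterD kP lfun_iter0 scaler0.
Qed.

(** Nilpotency of g is only asked on the image of f, because f is meant to be the projection
    onto a generalized eigenspace of g + a. *)
Lemma nilpotent_comp_local f g : (forall v, f (g v) = g (f v)) ->
  (forall v, loc_nilpotent g (f v)) -> nilpotent_lfun (f \o g)%VF.
Proof.
move=> fg gf; apply: nilpotent_of_local => v; have [m gm] := gf v.
exists m.+1.
have fgk j u : f (iter j g u) = iter j g (f u) by apply: iter_comm => w; rewrite fg.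
have iterE j u : iter j (f \o g)%VF u = iter j g (iter j f u).
  by elim: j => //= j ->; rewrite comp_lfunE -fgk -fg -iterS.
rewrite iterE (iterSr m f) iterS.
have gfk j w : iter m g (iter j f w) = iter j f (iter m g w).
  by elim: j => //= j <-; rewrite fgk.
rewrite gfk.
by rewrite gm lfun_iter0 linear0.
Qed.

Lemma nilpotent_comp f g : (forall v, f (g v) = g (f v)) -> nilpotent_lfun g ->
  nilpotent_lfun (f \o g)%VF.
Proof. by move=> fg [k gk]; apply: nilpotent_comp_local => // v; exists k. Qed.

End LocalNil.

(** * Lie brackets and the Killing form *)

Section LieAlgebra.
Variables (K : fieldType) (S : symLieAlg K).
Implicit Types (x y z : S) (D : 'End(S)) (I J L U W : {vspace S}).
Local Notation ad := (ad S).
Local Notation theta := (theta S).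

Lemma lieDl x y z : lie (x + y) z = lie x z + lie y z.
Proof. by rewrite /lie linearD add_lfunE. Qed.
Lemma lieDr x y z : lie x (y + z) = lie x y + lie x z.
Proof. by rewrite /lie linearD. Qed.
Lemma lieZl (c : K) x y : lie (c *: x) y = c *: lie x y.
Proof. by rewrite /lie linearZ scale_lfunE. Qed.
Lemma lieZr (c : K) x y : lie x (c *: y) = c *: lie x y.
Proof. by rewrite /lie linearZ. Qed.
Lemma lie0l x : lie 0 x = 0 :> S.
Proof. by rewrite /lie linear0 zero_lfunE. Qed.
Lemma lie0r x : lie x 0 = 0 :> S.
Proof. by rewrite /lie linear0. Qed.
Lemma lieNl x y : lie (- x) y = - lie x y.
Proof. by rewrite /lie linearN opp_lfunE. Qed.
Lemma lieNr x y : lie x (- y) = - lie x y.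
Proof. by rewrite /lie linearN. Qed.
Lemma lieBl x y z : lie (x - y) z = lie x z - lie y z.
Proof. by rewrite lieDl lieNl. Qed.
Lemma lieBr x y z : lie x (y - z) = lie x y - lie x z.
Proof. by rewrite lieDr lieNr. Qed.

Lemma lie_suml (I : Type) (r : seq I) (P : pred I) (F : I -> S) y :
  lie (\sum_(i <- r | P i) F i) y = \sum_(i <- r | P i) lie (F i) y.
Proof. by elim/big_rec2: _ => [|i u v _ <-]; rewrite ?lie0l ?lieDl. Qed.
Lemma lie_sumr (I : Type) (r : seq I) (P : pred I) (F : I -> S) x :
  lie x (\sum_(i <- r | P i) F i) = \sum_(i <- r | P i) lie x (F i).
Proof. by elim/big_rec2: _ => [|i u v _ <-]; rewrite ?lie0r ?lieDr. Qed.

Lemma lieC x y : lie x y = - lie y x.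
Proof.
apply/eqP; rewrite -addr_eq0; apply/eqP.
have := lie_alt (x + y); rewrite -/(lie _ _) lieDl !lieDr /lie !lie_alt.
by rewrite add0r addr0.
Qed.

Lemma lie_jac x y z : lie x (lie y z) = lie (lie x y) z + lie y (lie x z).
Proof.
have /eqP := lie_jacobi x y z; rewrite -!/(lie _ _) -addrA addr_eq0 => /eqP->.
by rewrite opprD addrC -lieC (lieC z x) lieNr opprK.
Qed.

Lemma ad_lie x y : ad (lie x y) = ((ad x \o ad y) - (ad y \o ad x))%VF.
Proof.
apply/lfunP => z; rewrite add_lfunE opp_lfunE !comp_lfunE -!/(lie _ _).
by rewrite (lie_jac x) addrK.
Qed.

Definition killing x y : K := lfun_trace (ad x \o ad y)%VF.

Lemma killingC x y : killing x y = killing y x.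
Proof. exact: lfun_trace_comp. Qed.

Lemma killingDl x y z : killing (x + y) z = killing x z + killing y z.
Proof. by rewrite /killing linearD comp_lfunDl linearD. Qed.
Lemma killingZl (c : K) x z : killing (c *: x) z = c * killing x z.
Proof. by rewrite /killing linearZ /= -comp_lfunZl linearZ. Qed.
Lemma killingDr x y z : killing x (y + z) = killing x y + killing x z.
Proof. by rewrite killingC killingDl !(killingC _ x). Qed.
Lemma killingZr (c : K) x z : killing x (c *: z) = c * killing x z.
Proof. by rewrite killingC killingZl (killingC _ x). Qed.
Lemma killing0l x : killing 0 x = 0.
Proof. by rewrite -(scale0r 0) killingZl mul0r. Qed.
Lemma killingNl x y : killing (- x) y = - killing x y.
Proof. by rewrite -scaleN1r killingZl mulN1r. Qed.
Lemma killingNr x y : killing x (- y) = - killing x y.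
Proof. by rewrite -scaleN1r killingZr mulN1r. Qed.

Lemma killing_linear x : linear (killing x : S -> K^o).
Proof. by move=> c y z; rewrite killingDr killingZr. Qed.
HB.instance Definition _ x := GRing.isLinear.Build K S K^o _ (killing x) (killing_linear x).

Lemma killing_sumr (I : Type) (r : seq I) (F : I -> S) x :
  killing x (\sum_(i <- r) F i) = \sum_(i <- r) killing x (F i).
Proof. exact: (linear_sum (killing x : S -> K^o)). Qed.
Lemma killing_suml (I : Type) (r : seq I) (F : I -> S) x :
  killing (\sum_(i <- r) F i) x = \sum_(i <- r) killing (F i) x.
Proof. by rewrite killingC killing_sumr; apply: eq_bigr => i _; apply: killingC. Qed.

Lemma killing_invariant x y z : killing (lie x y) z = killing x (lie y z).
Proof.
rewrite /killing !ad_lie comp_lfunDl comp_lfunDr comp_lfunNl comp_lfunNr.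
rewrite !linearB /= comp_lfunA; congr (_ - _).
by rewrite -comp_lfunA lfun_trace_comp -!comp_lfunA.
Qed.

Lemma ad_theta x : ad (theta x) = (theta \o ad x \o theta)%VF.
Proof.
apply/lfunP => y; rewrite !comp_lfunE -{1}(theta_invol y).
by rewrite [LHS](_ : _ = theta (lie x (theta y))) // theta_lie.
Qed.

(** An automorphism preserves the Killing form, hence k and p are orthogonal. *)
Lemma killing_theta x y : killing (theta x) (theta y) = killing x y.
Proof.
rewrite /killing !ad_theta -!comp_lfunA (comp_lfunA theta theta).
have -> : (theta \o theta = \1)%VF by apply/lfunP => u; rewrite comp_lfunE theta_invol id_lfunE.
rewrite comp_lfun1l lfun_trace_comp -!comp_lfunA.
have -> : (theta \o theta = \1)%VF by apply/lfunP => u; rewrite comp_lfunE theta_invol id_lfunE.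
by rewrite comp_lfun1r.
Qed.

Lemma mem_kk x : (x \in kk S) = (theta x == x).
Proof.
by rewrite /kk /leigenspace memv_ker add_lfunE opp_lfunE scale_lfunE id_lfunE scale1r subr_eq0.
Qed.

Lemma mem_pp x : (x \in pp S) = (theta x == - x).
Proof.
by rewrite /pp /leigenspace memv_ker add_lfunE opp_lfunE scale_lfunE id_lfunE scaleN1r opprK
  addr_eq0.
Qed.

Lemma lie_kk_pp x y : x \in kk S -> y \in pp S -> lie x y \in pp S.
Proof. by rewrite mem_kk !mem_pp => /eqP tx /eqP ty; rewrite theta_lie tx ty -/(lie _ _) lieNr. Qed.
Lemma lie_pp_pp x y : x \in pp S -> y \in pp S -> lie x y \in kk S.
Proof. by rewrite mem_kk !mem_pp => /eqP tx /eqP ty; rewrite theta_lie tx ty -/(lie _ _) lieNr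
  lieNl opprK. Qed.

(** * Ideals and the center *)

(** The ideal [g, I], for an ideal I. *)
Definition derived I : {vspace S} := <<[seq lie x y | x <- vbasis {:S}, y <- vbasis I]>>%VS.

Lemma mem_derived I x y : y \in I -> lie x y \in derived I.
Proof.
move=> yI; rewrite (coord_vbasis (memvf x)) (coord_vbasis yI) lie_suml.
apply: memv_suml => i _; rewrite lie_sumr memv_suml // => j _.
rewrite lieZl lieZr !memvZ // memv_span //.
by apply/allpairsP; exists ((vbasis {:S})`_i, (vbasis I)`_j); rewrite !mem_nth ?size_tuple.
Qed.

Lemma derived_sub I (T : {vspace S}) : (forall x y, y \in I -> lie x y \in T) ->
  (derived I <= T)%VS.
Proof.
move=> IT; apply/span_subvP => _ /allpairsP[[x y] /= [_ yI ->]].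
by apply: IT; apply: vbasis_mem.
Qed.

Lemma derived_subI I : is_ideal ad I -> (derived I <= I)%VS.
Proof. by move=> idI; apply: derived_sub => x y; apply: idI. Qed.

Lemma derived_ideal I : is_ideal ad I -> is_ideal ad (derived I).
Proof. by move=> /derived_subI/subvP sI x y /sI; apply: mem_derived. Qed.

Lemma derivedS I J : (I <= J)%VS -> (derived I <= derived J)%VS.
Proof. by move=> /subvP IJ; apply: derived_sub => x y /IJ; apply: mem_derived. Qed.

Lemma ideal_disjoint I J x y : is_ideal ad I -> is_ideal ad J ->
  (I :&: J = 0)%VS -> x \in I -> y \in J -> lie x y = 0.
Proof.
move=> idI idJ IJ0 xI yJ; apply/eqP; rewrite -memv0 -IJ0 memv_cap.
by rewrite {1}lieC memvN [_ \in I]idI // [_ \in J]idJ.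
Qed.

(** In a reductive algebra [g, I] has a complementary ideal J. An element of I is the sum of an
    element of [g, I] and one of J and I, and the brackets of g with the latter are 0 because
    they lie in both [g, I] and J. *)
Lemma derived_derived I : is_ideal ad I -> derived (derived I) = derived I.
Proof.
move=> idI; have idG := derived_ideal idI.
apply/eqP; rewrite eqEsubv derivedS ?derived_subI //=.
have [J [idJ sum0 cap0]] := lie_reductive idG.
apply: derived_sub => x y yI.
have /memv_addP[u uG [j jJ yE]] : y \in (derived I + J)%VS by rewrite sum0 memvf.
have jI : j \in I.
  have -> : j = y - u by rewrite yE addrC addKr.
  by rewrite memvB // (subvP (derived_subI idI)).
suff xj0 : lie x j = 0 by rewrite yE lieDr xj0 addr0 mem_derived.
by apply/eqP; rewrite -memv0 -cap0 memv_cap mem_derived // [_ \in J]idJ.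
Qed.

Definition center : {vspace S} := lker ad.

Lemma centerP x : reflect (forall y, lie x y = 0) (x \in center).
Proof.
rewrite memv_ker; apply: (iffP eqP) => [x0 y|x0]; first by rewrite /lie x0 zero_lfunE.
by apply/lfunP => y; rewrite zero_lfunE -/(lie x y).
Qed.

Lemma fullv_ideal : is_ideal ad fullv. Proof. by move=> *; apply: memvf. Qed.

Lemma center_ideal : is_ideal ad center.
Proof. by move=> x y /centerP y0; rewrite -/(lie x y) lieC y0 oppr0 mem0v. Qed.

(** A complementary ideal J of [g, g] is central, because [g, J] lies in both. *)
Lemma center_split x : exists z w, [/\ z \in center, w \in derived fullv & x = z + w].
Proof.
have [J [idJ sum0 cap0]] := lie_reductive (derived_ideal fullv_ideal).
have /memv_addP[w wG [z zJ ->]] : x \in (derived fullv + J)%VS by rewrite sum0 memvf.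
exists z, w; split=> //; last by rewrite addrC.
apply/centerP => y; apply/eqP; rewrite -memv0 -cap0 memv_cap.
by rewrite mem_derived ?memvf // lieC memvN [_ \in J]idJ.
Qed.

Lemma center_cap x : x \in center -> x \in derived fullv -> x = 0.
Proof.
move=> xZ xG; have [J [idJ sum0 cap0]] := lie_reductive center_ideal.
apply/eqP; rewrite -memv0 -cap0 memv_cap xZ /=.
apply: subvP xG; apply: derived_sub => u v _.
have /memv_addP[z zZ [j jJ ->]] : v \in (center + J)%VS by rewrite sum0 memvf.
by move/centerP: zZ => z0; rewrite lieDr (lieC u) z0 oppr0 add0r [_ \in J]idJ.
Qed.

(** * Engel's theorem *)

Definition subalg L := forall x y, x \in L -> y \in L -> lie x y \in L.

(** Engel's theorem for the action of L on W modulo U, in which both are subspaces of the Lie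
    algebra itself. A maximal proper subalgebra H of L is normalized by some v outside H, by
    induction applied to the action of H on L / H; so L = H + K v. The vectors of W killed by H
    modulo U are stable under v, which is nilpotent and therefore kills one of them modulo U. *)
Lemma engel L : subalg L -> (forall x, x \in L -> nilpotent_lfun (ad x)) ->
  forall U W, ~~ (W <= U)%VS ->
    (forall x w, x \in L -> w \in W -> lie x w \in W) ->
    (forall x u, x \in L -> u \in U -> lie x u \in U) ->
  exists v, [/\ v \in W, v \notin U & forall x, x \in L -> lie x v \in U].
Proof.
have [n] := ubnP (\dim L); elim: n L => // n IHn L ltn subL nilL U W nWU LW LU.
have [L0|L0] := eqVneq L 0%VS.
  have /subvPn[v vW vU] := nWU; exists v; split=> // x.
  by rewrite L0 memv0 => /eqP->; rewrite lie0l mem0v.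
have [H [[subH sHL nHL] maxH]] : exists H, [/\ subalg H, (H <= L)%VS & H <> L] /\
    forall H', [/\ subalg H', (H' <= L)%VS & H' <> L] -> (\dim H' <= \dim H)%N.
  apply: (@exists_max _ _ _ (\dim L) 0%VS) => [H' [_ /dimvS //]|].
  split; [|exact: sub0v|by move=> L0'; rewrite -L0' eqxx in L0].
  by move=> x y; rewrite !memv0 => /eqP-> _; rewrite lie0l.
have ltHn : (\dim H < n)%N.
  rewrite ltnS in ltn; apply: leq_trans ltn; rewrite ltn_neqAle dimvS // andbT.
  by apply/eqP => eqd; apply: nHL; apply/eqP; rewrite eqEdim sHL eqd leqnn.
have nilH x : x \in H -> nilpotent_lfun (ad x) by move=> /(subvP sHL)/nilL.
have [v [vL vH Hv]] : exists v, [/\ v \in L, v \notin H & forall x, x \in H -> lie x v \in H].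
  apply: (IHn H) => //; last by move=> x w /(subvP sHL) xL; apply: subL.
  by apply/negP => sLH; apply: nHL; apply/eqP; rewrite eqEsubv sHL.
have HvL : (H + <[v]>)%VS = L.
  apply: NNPP => nL; have := maxH (H + <[v]>)%VS => mx; suff /mx : [/\ subalg (H + <[v]>)%VS,
    (H + <[v]> <= L)%VS & (H + <[v]>)%VS <> L].
    rewrite leqNgt -[in X in (X < _)%N](addn0 (\dim H)) => /negP; apply.
    rewrite dimv_disjoint_sum ?ltn_add2l ?dim_vline; last first.
      apply/eqP; rewrite -subv0; apply/subvP => u; rewrite memv_cap => /andP[uH /vlineP[c uE]].
      have [c0|c0] := eqVneq c 0; first by rewrite uE c0 scale0r mem0v.
      by case/negP: vH; rewrite -(scalerK c0 v) memvZ // -uE.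
    by rewrite lt0b; apply: contraNneq vH => ->; rewrite mem0v.
  split=> //; last by rewrite subv_add sHL -memvE.
  move=> _ _ /memv_addP[h hH [_ /vlineP[c ->] ->]] /memv_addP[k kH [_ /vlineP[d ->] ->]].
  rewrite lieDl !lieDr !lieZl !lieZr [lie v v]lie_alt !scaler0 addr0.
  have vk : lie v k \in H by rewrite lieC memvN Hv.
  by rewrite (subvP (addvSl H _)) // !memvD ?memvZ // ?(subH _ _ hH kH) ?(Hv _ hH).
have [w [wW wU Hw]] : exists w, [/\ w \in W, w \notin U & forall x, x \in H -> lie x w \in U].
  by apply: (IHn H) => // x w /(subvP sHL); [apply: LW|apply: LU].
have [u [uW uU Hu vu]] : exists u, [/\ u \in W, u \notin U,
    forall x, x \in H -> lie x u \in U & lie v u \in U].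
  have [k vk] := nilL v vL; have {vk} : iter k (ad v) w \in U by rewrite vk mem0v.
  elim: k w wW wU Hw => [|k IHk] w wW wU Hw; first by rewrite (negPf wU).
  have [vwU _|vwU] := boolP (lie v w \in U); first by exists w.
  rewrite iterSr; apply: IHk => //; first exact: LW.
  move=> x xH; rewrite -/(lie v w) lie_jac memvD //; first by apply/Hw/Hv.
  by apply: LU => //; apply: Hw.
exists u; split=> // x; rewrite -HvL => /memv_addP[h hH [_ /vlineP[c ->] ->]].
by rewrite lieDl lieZl memvD // ?memvZ // Hu.
Qed.

End LieAlgebra.

(** * Derivations *)

Section Cartan.
Variables (K : closedFieldType) (charK0 : [pchar K] =i pred0) (S : symLieAlg K).
Implicit Types (x y z : S) (D : 'End(S)) (I J L U W : {vspace S}).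
Local Notation ad := (ad S).
Local Notation theta := (theta S).

Definition derivation D := forall x y, D (lie x y) = lie (D x) y + lie x (D y).

Lemma gen_eigen_lie x (a b : K) u v : gen_eigen (ad x) a u -> gen_eigen (ad x) b v ->
  gen_eigen (ad x) (a + b) (lie u v).
Proof.
case=> k uk [l vl].
suff main n : forall k l u v, (k + l <= n)%N -> iter k (ad x - a *: \1)%VF u = 0 ->
    iter l (ad x - b *: \1)%VF v = 0 -> iter n (ad x - (a + b) *: \1)%VF (lie u v) = 0.
  by exists (k + l)%N; apply: main uk vl.
elim: n => [|n IHn] [|k'] [|l'] u' v' // le uk' vl'; try by
  rewrite /= in uk'; rewrite uk' lie0l lfun_iter0.
  by rewrite /= in vl'; rewrite vl' lie0r lfun_iter0.
rewrite addSn addnS !ltnS in le.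
have iter_add j (f : 'End(S)) p q : iter j f (p + q) = iter j f p + iter j f q.
  by elim: j => //= j ->; rewrite linearD.
have -> : iter n.+1 (ad x - (a + b) *: \1)%VF (lie u' v') =
    iter n (ad x - (a + b) *: \1)%VF
      (lie ((ad x - a *: \1)%VF u') v' + lie u' ((ad x - b *: \1)%VF v')).
  rewrite iterSr !shiftE -!/(lie x _) lie_jac lieBl lieBr lieZl lieZr (scalerDl (lie u' v')).
  by rewrite opprD addrACA.
rewrite iter_add (IHn k' l'.+1) ?addnS -?iterSr // (IHn k'.+1 l') ?addSn -?iterSr //.
exact: addr0.
Qed.

(** The generalized eigenspaces of ad x grade the algebra, and a function of the degree that is
    additive on the eigenvalues defines a derivation. *)
Lemma calculus_derivation x (s : seq K) (e : K -> 'End(S)) (c : K -> K) :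
  (forall v, \sum_(a <- s) e a v = v) ->
  (forall a v, a \in s -> gen_eigen (ad x) a (e a v)) ->
  (forall (c : K -> K) b v, gen_eigen (ad x) b v -> (\sum_(a <- s) c a *: e a) v = c b *: v) ->
  (forall a b, a \in s -> b \in s -> a + b \in s -> c (a + b) = c a + c b) ->
  derivation (\sum_(a <- s) c a *: e a).
Proof.
move=> s1 sg sc cD u v; set D := \sum_(a <- s) _.
have Dg a w : gen_eigen (ad x) a w -> D w = c a *: w by apply: sc.
rewrite -(s1 u) lie_suml !linear_sum !lie_suml -big_split /=.
apply: eq_big_seq => a as_; rewrite -(s1 v) lie_sumr !linear_sum !lie_sumr -big_split /=.
apply: eq_big_seq => b bs; have ga := sg a u as_; have gb := sg b v bs.
have gab := gen_eigen_lie ga gb; rewrite !(Dg _ _ ga, Dg _ _ gb, Dg _ _ gab) lieZl lieZr -scalerDl.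
have [abs|abs] := boolP (a + b \in s); first by rewrite cD.
suff -> : lie (e a u) (e b v) = 0 by rewrite !scaler0.
have := sc (fun t => (t == a + b)%:R) _ _ gab; rewrite eqxx scale1r => <-.
rewrite big_seq big1 ?zero_lfunE // => t ts.
by case: eqP abs => [<-|_ _]; rewrite ?ts ?scale0r.
Qed.

Lemma ad_derivation D y : derivation D -> ad (D y) = ((D \o ad y) - (ad y \o D))%VF.
Proof.
move=> dD; apply/lfunP => z; rewrite add_lfunE opp_lfunE !comp_lfunE -!/(lie _ _).
by rewrite dD addrK.
Qed.

(** This identity lets the trace of D against [g, I] be computed by the Killing form. *)
Lemma derivation_trace D y z : derivation D -> lfun_trace (D \o ad (lie y z))%VF = killing (D y) z.
Proof.
move=> dD; rewrite /killing ad_derivation // ad_lie comp_lfunDr comp_lfunDl comp_lfunNl comp_lfunNr.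
rewrite !linearB /= -!comp_lfunA; congr (_ - _).
by rewrite [RHS]lfun_trace_comp -!comp_lfunA.
Qed.

(** On the generalized eigenspace for a, ad x is a plus a nilpotent map, so its trace there is a
    times the dimension m. *)
Lemma lfun_trace_eigenprojection x (s : seq K) (e : K -> 'End(S)) a :
  uniq s -> a \in s ->
  (forall a v, a \in s -> gen_eigen (ad x) a (e a v)) ->
  (forall (c : K -> K) b v, gen_eigen (ad x) b v -> (\sum_(a <- s) c a *: e a) v = c b *: v) ->
  (forall v, e a (ad x v) = ad x (e a v)) ->
  exists m : nat, [/\ lfun_trace (e a) = m%:R, (m = 0%N -> e a = 0) &
    lfun_trace (e a \o ad x)%VF = a * m%:R].
Proof.
move=> us as_ sg sc sC.
have ea v : gen_eigen (ad x) a v -> e a v = v.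
  move=> /(sc (fun t => (t == a)%:R)); rewrite eqxx scale1r => scv.
  rewrite -[RHS]scv sum_lfunE (bigD1_seq a) //= eqxx scale1r big1 ?addr0 // => t /negPf->.
  by rewrite scale0r zero_lfunE.
have idem : (e a \o e a)%VF = e a.
  by apply/lfunP => v; rewrite comp_lfunE; apply: ea; apply: sg.
have [m [tm m0]] := lfun_trace_idempotent idem; exists m; split=> //.
have /lfun_trace_nilpotent : nilpotent_lfun (e a \o (ad x - a *: \1))%VF.
  apply: nilpotent_comp_local => [v|v]; last by have := sg a v as_.
  by rewrite !shiftE linearB linearZ /= sC.
rewrite comp_lfunDr comp_lfunNr -comp_lfunZr comp_lfun1r linearB linearZ /=.
by rewrite tm => /eqP; rewrite subr_eq0 => /eqP.
Qed.

(** * Cartan's criterion *)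

Definition killing_form x : 'Hom(S, K^o) := linfun (killing x : S -> K^o).

Lemma killing_formE x y : killing_form x y = killing x y.
Proof. exact: lfunE. Qed.

Lemma killing_form_linear : linear killing_form.
Proof.
move=> c x y; apply/lfunP => z; rewrite add_lfunE scale_lfunE !killing_formE.
by rewrite killingDl killingZl.
Qed.
HB.instance Definition _ := GRing.isLinear.Build K S 'Hom(S,
  K^o) _ killing_form killing_form_linear.

Definition killing_radical : {vspace S} := lker (linfun killing_form).

Lemma killing_radicalP x : reflect (forall y, killing x y = 0) (x \in killing_radical).
Proof.
rewrite memv_ker lfunE /=; apply: (iffP eqP) => [x0 y|x0].
  by rewrite -killing_formE x0 zero_lfunE.
by apply/lfunP => y; rewrite killing_formE zero_lfunE x0.
Qed.

Lemma killing_radical_ideal : is_ideal ad killing_radical.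
Proof.
move=> x y /killing_radicalP y0; apply/killing_radicalP => z;
  rewrite -/(lie x y) lieC killingNl killing_invariant.
by rewrite y0 oppr0.
Qed.

(** Let m_a be the dimension of the generalized eigenspace of ad x for a, and suppose that it is
    not 0 for some a0 <> 0. Take a rational functional c with c(a0) <> 0 and let the derivation
    D act as c(a) on the eigenspace for a. Since x is in [g, I] for an ideal I contained in the
    radical, the trace of D ad x is 0, that is, the sum of the c(a) m_a a is 0. Applying c to
    this relation gives that the sum of the rationals m_a c(a)^2 is 0, a contradiction. *)
Lemma killing_radical_nilpotent x : x \in derived killing_radical -> nilpotent_lfun (ad x).
Proof.
rewrite -derived_derived; last exact: killing_radical_ideal.
set I := derived killing_radical => xI.
have [s [e [us s1 sg sc sC]]] := jordan_calculus (ad x).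
have /choice[m mP] a : exists m : nat, a \in s -> [/\ lfun_trace (e a) = m%:R, (m = 0%N ->
  e a = 0) &
    lfun_trace (e a \o ad x)%VF = a * m%:R].
  have [as_|] := boolP (a \in s); last by exists 0%N.
  have [m mP] := lfun_trace_eigenprojection us as_ sg sc (fun v => sC (ad x) (fun _ => erefl) a v).
  by exists m.
have e0 a : a \in s -> a != 0 -> e a = 0.
  move=> as_ a0; have [c [ca0 crel]] := rational_functional charK0 us as_ a0.
  pose F : {rmorphism rat -> K} := rat_to charK0.
  pose D := \sum_(a <- s) F (c a) *: e a.
  have sum1 (g : K -> rat) b : b \in s -> \sum_(t <- s) (t == b)%:R * g t = g b.
    move=> bs; rewrite (bigD1_seq b) //= eqxx mul1r big1 ?addr0 // => t /negPf->.
    exact: mul0r.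
  have sum1K b : b \in s -> \sum_(t <- s) F (t == b)%:R * t = b.
    move=> bs; rewrite (bigD1_seq b) //= eqxx rmorph1 mul1r big1 ?addr0 // => t /negPf->.
    by rewrite rmorph0 mul0r.
  have dD : derivation D.
    apply: (calculus_derivation s1 sg (c := fun a => F (c a))) => // p q ps qs pqs.
    pose r t : rat := (t == p)%:R + (t == q)%:R - (t == p + q)%:R.
    have : \sum_(t <- s) F (r t) * t = 0.
      under eq_bigr => t _ do rewrite rmorphB rmorphD /= mulrBl mulrDl.
      by rewrite sumrB big_split /= !sum1K // subrr.
    move/crel; under eq_bigr => t _ do rewrite /r mulrBl mulrDl.
    rewrite sumrB big_split /= !sum1 // => /eqP; rewrite subr_eq0 => /eqP <-.
    by rewrite rmorphD.
  have trD0 w : w \in derived I -> lfun_trace (D \o ad w)%VF = 0.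
    have lin : linear (fun w => lfun_trace (D \o ad w)%VF : K^o).
      by move=> k u v; rewrite linearP comp_lfunDr -comp_lfunZr linearP.
    pose M := GRing.isLinear.Build K S K^o _ (fun w => lfun_trace (D \o ad w)%VF : K^o) lin.
    pose phi : {linear S -> K^o} := HB.pack (fun w => lfun_trace (D \o ad w)%VF : K^o) M.
    suff /subvP sub : (derived I <= lker (linfun phi))%VS.
      by move=> /sub; rewrite memv_ker lfunE /= => /eqP.
    apply: derived_sub => y z zI; rewrite memv_ker lfunE /= derivation_trace //.
    have /killing_radicalP z0 : z \in killing_radical by apply: subvP zI;
      apply/derived_subI/killing_radical_ideal.
    by rewrite killingC z0.
  have := trD0 x xI; rewrite /D.
  have -> : ((\sum_(a <- s) F (c a) *: e a) \o ad x)%VF = \sum_(a <- s) F (c a) *: (e a \o ad x)%VF.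
    apply/lfunP => v; rewrite comp_lfunE !sum_lfunE; apply: eq_bigr => t _.
    by rewrite !scale_lfunE comp_lfunE.
  rewrite linear_sum /= => tr0.
  have /crel : \sum_(t <- s) F (c t * (m t)%:R) * t = 0.
    rewrite -[RHS]tr0; apply: eq_big_seq => t ts; rewrite linearZ /=.
    have [_ _ ->] := mP t ts; rewrite rmorphM rmorph_nat -[RHS]/(_ * _) -mulrA.
    by rewrite (mulrC t).
  have sq_ge0 t : (0 <= c t * (m t)%:R * c t)%R.
    by rewrite mulrAC Num.Theory.mulr_ge0 ?Num.Theory.ler0n // -expr2 Num.Theory.sqr_ge0.
  move/eqP; rewrite Num.Theory.psumr_eq0 // => /allP/(_ a as_) /=.
  rewrite !mulf_eq0 (negPf ca0) /= orbF Num.Theory.pnatr_eq0 => /eqP m0.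
  by have [_ + _] := mP a as_; apply.
apply: nilpotent_of_local => v; rewrite -(s1 v); apply: loc_nilpotent_sum => a as_.
have [a0|/(e0 _ as_)->] := eqVneq a 0; last by exists 0%N; rewrite /= zero_lfunE.
by have := sg a v as_; rewrite /gen_eigen a0 scale0r subr0.
Qed.

(** The ideal I = [g, R], where R is the radical of the form, consists of ad-nilpotent elements.
    If it is not 0, Engel's theorem provides a nonzero v in I that commutes with I. It also
    commutes with a complementary ideal, so it is central, and it lies in [g, g]: this is
    impossible in a reductive algebra. *)
Lemma killing_radical_center x : (forall y, killing x y = 0) -> x \in center S.
Proof.
move=> /killing_radicalP xR; set I := derived killing_radical.
have idI : is_ideal ad I by apply/derived_ideal/killing_radical_ideal.
suff I0 : I = 0%VS.
  apply/centerP => y; apply/eqP; rewrite lieC oppr_eq0 -memv0 -I0.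
  exact: mem_derived.
apply: NNPP => I0.
have [v [vI v0 Iv]] : exists v, [/\ v \in I, v \notin 0%VS &
    forall y, y \in I -> lie y v \in 0%VS].
  apply: (engel (L := I)) => [y z _|||y w _|y u _]; try exact: idI.
  - exact: killing_radical_nilpotent.
  - by apply/negP; rewrite subv0 => /eqP.
  - by rewrite memv0 => /eqP->; rewrite lie0r mem0v.
case/negP: v0; rewrite memv0; apply/eqP/center_cap; last first.
  by apply: subvP vI; apply/derivedS/subvf.
apply/centerP => y; have [J [idJ sum0 cap0]] := lie_reductive idI.
have /memv_addP[u uI [j jJ ->]] : y \in (I + J)%VS by rewrite sum0 memvf.
rewrite lieDr (ideal_disjoint idI idJ cap0 vI jJ) addr0 lieC.
by have := Iv u uI; rewrite memv0 => /eqP->; rewrite oppr0.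
Qed.

(** * Inner derivations and the Jordan decomposition *)

(** A linear form that vanishes on the radical of the Killing form, which is the center, is
    represented by an element. *)
Lemma derivation_killing D : derivation D ->
  exists s, forall z, killing s z = lfun_trace (D \o ad z)%VF.
Proof.
move=> dD; pose n := \dim {:S}; pose b := vbasis {:S}.
pose G : 'M[K]_n := \matrix_(i, j) killing b`_i b`_j.
pose phi : 'rV[K]_n := \row_j lfun_trace (D \o ad b`_j)%VF.
have bE z : z = \sum_(j < n) coord b j z *: b`_j by apply: coord_vbasis; apply: memvf.
have phiE (c : 'I_n -> K) : lfun_trace (D \o ad (\sum_j c j *: b`_j))%VF = \sum_j c j * phi 0 j.
  rewrite linear_sum /=.
  have -> : (D \o \sum_j ad (c j *: b`_j))%VF = \sum_j c j *: (D \o ad b`_j)%VF.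
    apply/lfunP => v; rewrite comp_lfunE !sum_lfunE linear_sum; apply: eq_bigr => j _.
    by rewrite linearZ /= scale_lfunE linearZ /= scale_lfunE comp_lfunE.
  by rewrite linear_sum; apply: eq_bigr => j _; rewrite linearZ /= mxE.
have /submxP[u uE] : (phi <= G)%MS.
  rewrite submxE; have := mulmx_coker G; move: (cokermx G) => C GC.
  apply/eqP/rowP => k; rewrite !mxE.
  pose z := \sum_(j < n) C j k *: b`_j.
  have z0 : ad z = 0.
    apply/eqP; rewrite -memv_ker; apply: killing_radical_center => y.
    rewrite (bE y) killing_sumr big1 // => i _; rewrite killingZr killingC killing_sumr.
    have /(congr1 (fun A : 'M_n => A i k)) := GC.
    rewrite !mxE => G0; rewrite [X in _ * X](_ : _ = 0) ?mulr0 // -[RHS]G0.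
    by apply: eq_bigr => j _; rewrite killingZr /G mxE mulrC.
  rewrite -[RHS](linear0 (@lfun_trace _ _) : lfun_trace (0 :
    'End(S)) = 0) -(comp_lfun0r _ D) -z0 /z phiE.
  by apply: eq_bigr => j _; rewrite mulrC.
exists (\sum_(i < n) u 0 i *: b`_i) => z; rewrite (bE z) phiE killing_sumr.
apply: eq_bigr => j _; rewrite killingZr; congr (_ * _).
rewrite killing_suml uE mxE; apply: eq_bigr => i _.
by rewrite killingZl /G mxE.
Qed.

(** With s representing z |-> tr (D ad z), the derivation E = D - ad s has its values in the
    radical of the Killing form, hence in the center; then E kills [g, g], and it kills the
    center by hypothesis. *)
Lemma derivation_inner D : derivation D -> (forall z, z \in center S -> D z = 0) ->
  exists s, ad s = D.
Proof.
move=> dD DZ; have [s sP] := derivation_killing dD; exists s.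
pose E := D - ad s.
have EE v : E v = D v - lie s v by rewrite /E add_lfunE opp_lfunE.
have dE : derivation E.
  move=> u v; rewrite !EE dD (lie_jac s) lieBl lieBr opprD addrACA.
  by [].
have EZ y : E y \in center S.
  apply: killing_radical_center => z; rewrite -derivation_trace // /E comp_lfunDl comp_lfunNl
    linearB /=.
  by rewrite -sP subrr.
apply/esym/eqP; rewrite -subr_eq0 -/E; apply/eqP/lfunP => v; rewrite zero_lfunE.
have [z [w [zZ wG ->]]] := center_split v.
have -> : E (z + w) = E w.
  by rewrite linearD /= (EE z) DZ // lieC; move/centerP: zZ => ->; rewrite oppr0 subr0 add0r.
apply/eqP; rewrite -memv_ker; apply: subvP wG; apply: derived_sub => x y _.
rewrite memv_ker dE; have /centerP-> := EZ x; rewrite lieC.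
by have /centerP-> := EZ y; rewrite oppr0 addr0.
Qed.

Lemma diag_lfun_calculus x (s : seq K) (e : K -> 'End(S)) :
  (forall v, \sum_(a <- s) e a v = v) ->
  (forall a v, a \in s -> gen_eigen (ad x) a (e a v)) ->
  (forall (c : K -> K) b v, gen_eigen (ad x) b v -> (\sum_(a <- s) c a *: e a) v = c b *: v) ->
  diag_lfun (\sum_(a <- s) a *: e a).
Proof.
move=> s1 sg sc; pose X := [seq e a b | a <- s, b <- vbasis {:S}].
apply: (@diag_lfun_span _ _ _ X) => [|_ /allpairsP[[a b] /= [as_ _ ->]]].
  apply/eqP; rewrite eqEsubv subvf /=; apply/subvP => v _; rewrite -(s1 v) big_seq.
  apply: memv_suml => a as_; rewrite (coord_vbasis (memvf v)) linear_sum memv_suml // => i _.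
  rewrite linearZ memvZ // memv_span //.
  by apply/allpairsP; exists (a, (vbasis {:S})`_i); rewrite mem_nth ?size_tuple.
by exists a; rewrite (sc id a) //; apply: sg.
Qed.

(** The semisimple part of ad x is a derivation, hence equal to some ad s. For x in p, its
    conjugate by theta is its opposite, since theta exchanges the eigenspaces of ad x for a and
    -a; so s may be replaced by its component in p. *)
Lemma jordan_ad x : exists s,
  [/\ diag_lfun (ad s), nilpotent_lfun (ad (x - s)), forall v, lie x v = 0 -> lie s v = 0 &
      x \in pp S -> s \in pp S].
Proof.
have [s [e [us s1 sg sc sC]]] := jordan_calculus (ad x).
pose D := \sum_(a <- s) a *: e a.
have Dg a v : gen_eigen (ad x) a v -> D v = a *: v by apply: sc.
have D0 v : lie x v = 0 -> D v = 0.
  move=> xv; rewrite (Dg 0) ?scale0r //; exists 1%N.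
  by rewrite /= shiftE -/(lie x v) xv scale0r subr0.
have dD : derivation D by apply: (calculus_derivation (c := id) s1 sg sc).
have DZ z : z \in center S -> D z = 0.
  by move=> /centerP z0; apply: D0; rewrite lieC z0 oppr0.
have [s0 s0D] := derivation_inner dD DZ.
have nilD : nilpotent_lfun (ad x - D).
  apply: nilpotent_of_local => v; rewrite -(s1 v); apply: loc_nilpotent_sum => a as_.
  have [k ek] := sg a v as_; exists k.
  suff E j w : gen_eigen (ad x) a w -> iter j (ad x - D) w = iter j (ad x - a *: \1)%VF w.
    by rewrite E //; apply: sg.
  move=> [l wl]; elim: j => //= j ->; rewrite shiftE add_lfunE opp_lfunE (Dg a) //.
  by exists l; rewrite -iterD addnC iterD wl lfun_iter0.
have [xp|xp] := boolP (x \in pp S); last first.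
  exists s0; split; rewrite ?linearB /= ?s0D //.
  - exact: diag_lfun_calculus s1 sg sc.
  - by move=> v xv; rewrite /lie s0D D0.
have thD v : theta (D (theta v)) = - D v.
  rewrite -(s1 v) !linear_sum /=; apply: eq_big_seq => a as_.
  have ga := sg a v as_; rewrite (Dg a (e a v)) //.
  rewrite (Dg (- a)); first by rewrite linearZ /= theta_invol scaleNr.
  have [k vk] := ga; exists k.
  suff E j w : iter j (ad x - (- a) *: \1)%VF (theta w) =
      (-1) ^+ j *: theta (iter j (ad x - a *: \1)%VF w).
    by rewrite E vk linear0 scaler0.
  elim: j => [|j IHj]; first by rewrite scale1r.
  rewrite iterS IHj linearZ /= exprSr -scalerA; congr (_ *: _).
  move: (iter j _ w) => u; rewrite !shiftE scaleN1r scaleNr opprK.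
  rewrite linearB linearZ /= opprB theta_lie -!/(lie _ _).
  move: xp; rewrite mem_pp => /eqP->; rewrite lieNl opprK addrC.
  by [].
have two0 : (2%:R : K) != 0 by rewrite natr_char0.
pose t := 2%:R^-1 *: (s0 - theta s0).
have tD : ad t = D.
  apply/lfunP => v; rewrite /t linearZ linearB /= ad_theta s0D scale_lfunE.
  rewrite add_lfunE opp_lfunE !comp_lfunE thD opprK -mulr2n -scaler_nat scalerA.
  by rewrite mulVf // scale1r.
exists t; split=> [|||_]; rewrite ?linearB /= ?tD //.
- exact: diag_lfun_calculus s1 sg sc.
- by move=> v xv; rewrite /lie tD D0.
- by rewrite mem_pp /t linearZ linearB /= theta_invol -scalerN opprB.
Qed.

End Cartan.

(** * Dimensions of images and kernels *)

Section DiagSum.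
Variables (K : closedFieldType) (V : vectType K).

Lemma diag_lfunD (f g : 'End(V)) : (forall v, f (g v) = g (f v)) ->
  diag_lfun f -> diag_lfun g -> diag_lfun (f + g).
Proof.
move=> fg [X [bX eX]] dg.
have [s [e [us s1 sg sc sC]]] := jordan_calculus g.
apply: (@diag_lfun_span _ _ _ [seq e a x | a <- s, x <- X]) => [|_ /allpairsP[[a x] /= [as_ xX
  ->]]].
  apply/eqP; rewrite eqEsubv subvf /=; apply/subvP => v _; rewrite -(s1 v) big_seq.
  apply: memv_suml => a as_; rewrite (coord_span (_ : v \in <<in_tuple X>>%VS)); last first.
    by rewrite /= (span_basis bX) memvf.
  rewrite linear_sum memv_suml // => i _; rewrite linearZ memvZ // memv_span //.
  by apply/allpairsP; exists (a, X`_i); rewrite mem_nth.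
have [c fx] := eX x xX; exists (c + a).
rewrite add_lfunE (diag_lfun_gen_eigen dg (sg a x as_)) scalerDl; congr (_ + _).
by rewrite -(sC f fg) fx linearZ.
Qed.

Lemma diag_lfunZ (c : K) (f : 'End(V)) : diag_lfun f -> diag_lfun (c *: f).
Proof.
case=> X [bX eX]; exists X; split=> // v /eX[d fv]; exists (c * d).
by rewrite scale_lfunE fv scalerA.
Qed.

Lemma diag_lfun0 : diag_lfun (0 : 'End(V)).
Proof.
by exists (vbasis fullv); split=> [|v _]; [exact: vbasisP|exists 0; rewrite zero_lfunE scale0r].
Qed.

(** A diagonalizable f that exchanges A and B has the same rank on both: on its image it is
    injective, and it maps f(A) into f(B) and f(B) into f(A). *)
Lemma diag_lfun_dim (f : 'End(V)) (A B : {vspace V}) : diag_lfun f ->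
  (forall v, v \in A -> f v \in B) -> (forall v, v \in B -> f v \in A) ->
  (\dim A + \dim (B :&: lker f) = \dim B + \dim (A :&: lker f))%N.
Proof.
move=> df fA fB.
have le (U W : {vspace V}) : (forall v, v \in U -> f v \in W) -> (\dim (f @: U) <= \dim (f @: W))%N.
  move=> fU; have ker0 : (f @: U :&: lker f = 0)%VS.
    apply/eqP; rewrite -subv0; apply/subvP => _ /memv_capP[/memv_imgP[u _ ->]].
    by rewrite memv_ker => /eqP/(diag_lfun_ker2 df)->; rewrite mem0v.
  rewrite -(limg_dim_eq ker0); apply/dimvS/limgS.
  by apply/subvP => _ /memv_imgP[u uU ->]; apply: fU.
have := limg_ker_dim f A; have := limg_ker_dim f B.
have /eqP : \dim (f @: A) == \dim (f @: B) by rewrite eqn_leq !le.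
lia.
Qed.

Lemma memv_bigcap (I : Type) (r : seq I) (U : I -> {vspace V}) v :
  (v \in (\bigcap_(i <- r) U i)%VS) = all (fun i => v \in U i) r.
Proof. by elim: r => [|i r IHr]; rewrite ?big_nil ?memvf // big_cons memv_cap IHr. Qed.

Lemma dim_forms (U : {vspace V}) (fs : seq 'Hom(V, K^o)) :
  (\dim U <= \dim (U :&: \bigcap_(f <- fs) lker f) + size fs)%N.
Proof.
elim: fs => [|f fs IHfs]; first by rewrite big_nil capvf addn0.
rewrite big_cons /= (capvC (lker f)) capvA.
have := limg_ker_dim f (U :&: \bigcap_(f <- fs) lker f).
have : (\dim (f @: (U :&: \bigcap_(f <- fs) lker f)) <= 1)%N.
  by rewrite (leq_trans (dimvS (subvf _))) // dimvf.
lia.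
Qed.

End DiagSum.

(** * Cartan subspaces *)

Section CartanSub.
Variables (K : closedFieldType) (charK0 : [pchar K] =i pred0) (S : symLieAlg K).
Implicit Types (x y z h : S).
Local Notation ad := (ad S).
Local Notation theta := (theta S).
Local Notation kk := (kk S).
Local Notation pp := (pp S).

Let two0 : (2%:R : K) != 0. Proof. by rewrite natr_char0. Qed.

Lemma kk_pp0 x : x \in kk -> x \in pp -> x = 0.
Proof.
rewrite mem_kk mem_pp => /eqP-> /eqP xx; apply/eqP.
have : 2%:R *: x == 0 by rewrite scaler_nat mulr2n {1}xx addNr.
by rewrite scaler_eq0 (negPf two0).
Qed.

Lemma kk_pp_split x : exists u v, [/\ u \in kk, v \in pp & x = u + v].
Proof.
exists (2%:R^-1 *: (x + theta x)), (2%:R^-1 *: (x - theta x)); split.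
- by rewrite mem_kk linearZ linearD /= theta_invol addrC.
- by rewrite mem_pp linearZ linearB /= theta_invol -scalerN opprB.
- rewrite -scalerDr addrACA subrr addr0 -mulr2n -scaler_nat scalerA mulVf //.
  by rewrite scale1r.
Qed.

Lemma killing_kk_pp x y : x \in kk -> y \in pp -> killing x y = 0.
Proof.
rewrite mem_kk mem_pp => /eqP tx /eqP ty; apply/eqP.
have : 2%:R * killing x y == 0.
  by rewrite mulr_natl mulr2n -{1}killing_theta tx ty killingNr addNr.
by rewrite mulf_eq0 (negPf two0).
Qed.

Section OneCartan.
Variables (a : {vspace S}) (Ca : is_Cartan_subspace a).

Let ator : is_toral a. Proof. by case: Ca. Qed.
Let aP h : h \in a -> h \in pp. Proof. by have [_ /subvP sap _] := Ca; apply: sap. Qed.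
Let adiag h : h \in a -> diag_lfun (ad h). Proof. by have [_ ss] := ator => /ss. Qed.

(** The bracket of two elements of p is in k, while a is a subalgebra of p. *)
Lemma cartan_abelian x y : x \in a -> y \in a -> lie x y = 0.
Proof.
move=> xa ya; apply: kk_pp0; first by apply: lie_pp_pp; apply: aP.
by apply: aP; have [cl _] := ator; apply: cl.
Qed.

(** A semisimple element of p commuting with a could be added to a; this is where maximality is
    used. *)
Lemma cartan_max s : s \in pp -> (forall h, h \in a -> lie h s = 0) -> diag_lfun (ad s) -> s \in a.
Proof.
move=> sp sa ds; have [_ sap maxa] := Ca.
suff <- : (a + <[s]>)%VS = a by rewrite memvE addvSr.
apply: maxa; [split| |exact: addvSl].
- move=> _ _ /memv_addP[h ha [_ /vlineP[c ->] ->]] /memv_addP[k ka [_ /vlineP[d ->] ->]].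
  rewrite lieDl !lieDr !lieZl !lieZr [lie s s]lie_alt cartan_abelian // sa //.
  by rewrite (lieC s) sa // oppr0 !scaler0 !addr0 mem0v.
- move=> _ /memv_addP[h ha [_ /vlineP[c ->] ->]].
  rewrite /semisimple_elt /lie linearD linearZ /=.
  apply: diag_lfunD; [|exact: adiag|exact: diag_lfunZ].
  move=> v; rewrite !scale_lfunE linearZ /= -!/(lie _ _); congr (_ *: _).
  by rewrite lie_jac sa // lie0l add0r.
- by rewrite subv_add sap -memvE.
Qed.

Let in_centralizer x := x \in pp /\ forall h, h \in a -> lie h x = 0.

(** The semisimple part of y commutes with a, and so belongs to a by maximality. *)
Lemma cartan_centralizer_split y : in_centralizer y ->
  exists h n, [/\ h \in a, in_centralizer n, nilpotent_lfun (ad n) & y = h + n].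
Proof.
move=> [yp ya]; have [s [ds nn s0 sp]] := jordan_ad charK0 y.
have sa h : h \in a -> lie h s = 0.
  by move=> ha; rewrite lieC s0 ?oppr0 // lieC ya ?oppr0.
exists s, (y - s); split=> //; last by rewrite addrC subrK.
- by apply: cartan_max => //; apply: sp.
- by split=> [|h ha]; [rewrite memvB ?sp|rewrite lieBr ya // sa // subrr].
Qed.

(** The element w' is the component of w in the common kernel of the ad h, for h in a: the other
    joint eigenspaces lie in some [h, g], to which x is orthogonal. *)
Lemma killing_centralizer x w : (forall h, h \in a -> lie h x = 0) ->
  exists w', (forall h, h \in a -> lie h w' = 0) /\ killing x w' = killing x w.
Proof.
move=> xa.
suff main (hs : seq S) : {subset hs <= a} ->
    exists w', (forall h, h \in hs -> lie h w' = 0) /\ killing x w' = killing x w.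
  have [|w' [w'0 kw]] := main (vbasis a); first by move=> h; apply: vbasis_mem.
  exists w'; split=> // h ha; rewrite (coord_vbasis ha) lie_suml big1 // => i _.
  by rewrite lieZl w'0 ?scaler0 ?mem_nth ?size_tuple.
elim: hs => [|h hs IHhs] sa; first by exists w.
have [|u [u0 ku]] := IHhs; first by move=> k kh; rewrite sa // inE kh orbT.
have ha : h \in a by rewrite sa ?mem_head.
have [s [e [us s1 sg sc sC]]] := jordan_calculus (ad h).
have he b v : b \in s -> lie h (e b v) = b *: e b v.
  by move=> bs; apply: diag_lfun_gen_eigen (sg b v bs); apply: adiag.
pose u1 := if 0 \in s then e 0 u else 0.
exists u1; split=> [k|].
  rewrite inE => /predU1P[->|kh].
    by rewrite /u1; case: ifP => [/he->|]; rewrite ?scale0r ?lie0r.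
  rewrite /u1; case: ifP => _; last by rewrite lie0r.
  have := sC (ad k) _ 0 u; rewrite -!/(lie _ _) u0 // linear0 => <- // v.
  have kh0 : lie k h = 0 by apply: cartan_abelian; rewrite // sa // inE kh orbT.
  by rewrite -!/(lie _ _) lie_jac kh0 lie0l add0r.
rewrite -ku -[in RHS](s1 u).
have other b : b \in s -> b != 0 -> killing x (e b u) = 0.
  move=> bs b0; apply: (mulfI b0); rewrite mulr0 -killingZr -he // -killing_invariant lieC xa //.
  by rewrite oppr0 killing0l.
rewrite killing_sumr /u1; case: ifP => [s0|/negbT s0].
  rewrite (bigD1_seq 0) //= big_seq_cond big1 ?addr0 // => b /andP[bs b0].
  exact: other.
rewrite big_seq big1 => [|b bs]; first by rewrite killingC killing0l.
by apply: other => //; apply: contraNneq s0 => <-.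
Qed.

(** The Killing form pairs the centralizer of a in p with itself only: it is enough to test x
    against the component in p of an element of the centralizer of a. *)
Lemma cartan_orthogonal x : in_centralizer x -> (forall y, in_centralizer y -> killing x y = 0) ->
  x \in center S.
Proof.
move=> [xp xa] x0; apply: killing_radical_center => // w.
have [w' [w'0 <-]] := killing_centralizer w xa.
have [u [v [uk vp wE]]] := kk_pp_split w'.
rewrite wE killingDr killingC killing_kk_pp // add0r; apply: x0; split=> // h ha.
have hv : lie h v = - lie h u.
  by apply/eqP; rewrite -addr_eq0 addrC -lieDr -wE w'0.
apply: kk_pp0; first by apply: lie_pp_pp => //; apply: aP.
rewrite hv memvN lieC memvN lie_kk_pp //; exact: aP.
Qed.

(** The centralizer of a in p is a plus its set of ad-nilpotent elements, and commuting with a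
    makes these orthogonal to a. The sum of two nilpotent elements n1 and n2 is h + n with h in
    a orthogonal to a, hence h is central and the sum is nilpotent. So the Killing form vanishes
    at n1, n2 and n1 + n2, and by polarization at the pair (n1, n2). A nilpotent n is then
    orthogonal to the whole centralizer, hence central, so that ad n = 0 is semisimple and n is
    in a by maximality. *)
Lemma cartan_self_centralizing y : in_centralizer y -> y \in a.
Proof.
have comm x z : lie x z = 0 -> forall v, ad x (ad z v) = ad z (ad x v).
  by move=> xz v; rewrite -!/(lie _ _) lie_jac xz lie0l add0r.
have kan h n : h \in a -> in_centralizer n -> nilpotent_lfun (ad n) -> killing h n = 0.
  move=> ha [np na] nn; rewrite /killing lfun_trace_nilpotent //; apply: nilpotent_comp => //.
  by apply: comm; apply: na.
have ka0 h : h \in a -> (forall k, k \in a -> killing h k = 0) -> h \in center S.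
  move=> ha h0; apply: cartan_orthogonal => [|z Pz].
    by split; [exact: aP|move=> k ka; exact: cartan_abelian].
  have [k [n [ka Pn nn ->]]] := cartan_centralizer_split Pz.
  by rewrite killingDr h0 // kan // addr0.
have nilD n1 n2 : in_centralizer n1 -> in_centralizer n2 -> nilpotent_lfun (ad n1) ->
  nilpotent_lfun (ad n2) -> nilpotent_lfun (ad (n1 + n2)).
  move=> P1 P2 nn1 nn2.
  have P12 : in_centralizer (n1 + n2).
    case: P1 P2 => p1 c1 [p2 c2]; split; first exact: memvD.
    by move=> h ha; rewrite lieDr c1 // c2 // addr0.
  have [h [n [ha Pn nn nE]]] := cartan_centralizer_split P12.
  have hZ : h \in center S.
    apply: ka0 => // k ka; rewrite killingC.
    have -> : h = n1 + n2 - n by rewrite nE addrK.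
    by rewrite !killingDr killingNr !kan // addr0 subr0.
  rewrite nE linearD /=; have -> : ad h = 0 by apply/eqP; rewrite -memv_ker.
  by rewrite add0r.
have knn n : nilpotent_lfun (ad n) -> killing n n = 0.
  by move=> nn; rewrite /killing lfun_trace_nilpotent //; apply: nilpotent_comp.
move=> /cartan_centralizer_split[h [n [ha Pn nn ->]]].
rewrite memvD //; apply: cartan_max; [by case: Pn|by case: Pn|].
suff nZ : n \in center S.
  have -> : ad n = 0 by apply/eqP; rewrite -memv_ker.
  exact: diag_lfun0.
apply: cartan_orthogonal => // z /cartan_centralizer_split[k [n' [ka Pn' nn' ->]]].
rewrite killingDr (killingC n k) kan // add0r.
have /eqP := knn _ (nilD _ _ Pn Pn' nn nn').
rewrite killingDl !killingDr !knn // add0r addr0 (killingC n') -mulr2n -mulr_natl.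
by rewrite mulf_eq0 (negPf two0) /= => /eqP.
Qed.

(** For h in a, ad h is semisimple and exchanges k and p, and these stay exchanged on the
    centralizer of other elements of a; so every element of a basis of a lowers the dimensions
    of the centralizers in k and in p by the same amount. In the end the latter is a. *)
Lemma cartan_dim : (\dim kk + \dim a = \dim pp + \dim (mm a))%N.
Proof.
have centE (hs : seq S) : {subset hs <= a} ->
    (\dim kk + \dim (pp :&: \bigcap_(u <- hs) lker (ad u)) =
     \dim pp + \dim (kk :&: \bigcap_(u <- hs) lker (ad u)))%N.
  elim: hs => [|h hs IHhs] sa; first by rewrite !big_nil !capvf addnC.
  have ha : h \in a by rewrite sa ?mem_head.
  have sa' : {subset hs <= a} by move=> k kh; rewrite sa // inE kh orbT.
  rewrite !big_cons !(capvC (lker (ad h))) !capvA.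
  have stab (U W : {vspace S}) : (forall v, v \in U -> lie h v \in W) ->
      forall v, v \in (U :&: \bigcap_(u <- hs) lker (ad u))%VS ->
        ad h v \in (W :&: \bigcap_(u <- hs) lker (ad u))%VS.
    move=> UW v; rewrite !memv_cap !memv_bigcap => /andP[/UW-> /allP v0] /=.
    apply/allP => k kh; have := v0 k kh; rewrite !memv_ker -!/(lie _ _) => /eqP kv.
    have kh0 : lie k h = 0 by apply: cartan_abelian; rewrite // sa'.
    by rewrite lie_jac kv kh0 lie0l lie0r addr0.
  have hk v : v \in kk -> lie h v \in pp.
    by move=> vk; rewrite lieC memvN lie_kk_pp // aP.
  have hp v : v \in pp -> lie h v \in kk by move=> vp; apply: lie_pp_pp => //; apply: aP.
  by have := IHhs sa'; have := diag_lfun_dim (adiag ha) (stab kk pp hk) (stab pp kk hp); lia.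
rewrite -(centE (vbasis a)); last by move=> h; apply: vbasis_mem.
congr (_ + \dim _)%N; apply/eqP; rewrite eqEsubv; apply/andP; split; apply/subvP => v.
  move=> va; rewrite memv_cap aP //= memv_bigcap; apply/allP => h /vbasis_mem ha.
  by rewrite memv_ker -/(lie h v) cartan_abelian.
rewrite memv_cap memv_bigcap => /andP[vp /allP v0]; apply: cartan_self_centralizing.
split=> // h ha; rewrite (coord_vbasis ha) lie_suml big1 // => i _.
have : (vbasis a)`_i \in vbasis a by rewrite mem_nth ?size_tuple.
by move=> /v0; rewrite memv_ker lieZl -/(lie _ _) => /eqP->; rewrite scaler0.
Qed.

End OneCartan.

(** * A criterion for rigidity *)

(** The kernel of ad x on k contains the elements of k orthogonal to [x, p], because kappa([x,
    k], v) = - kappa(k, [x, v]). They are cut out by dim [x, p] linear forms. *)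
Lemma dim_ad_kk_pp x : x \in pp -> (\dim (ad x @: kk) <= \dim (ad x @: pp))%N.
Proof.
move=> xp; pose W := (ad x @: pp)%VS; pose fs := [seq killing_form b | b <- vbasis W].
have sub : (kk :&: \bigcap_(f <- fs) lker f <= kk :&: lker (ad x))%VS.
  apply/subvP => k; rewrite !memv_cap memv_bigcap => /andP[kk' /allP k0].
  rewrite kk' memv_ker -/(lie x k) /=; apply/eqP/center_cap; last by rewrite mem_derived ?memvf.
  apply: killing_radical_center => // w; have [u [v [uk vp ->]]] := kk_pp_split w.
  rewrite killingDr killingC killing_kk_pp ?add0r //; last by rewrite lieC memvN lie_kk_pp.
  have vW : lie x v \in W by apply: memv_img.
  rewrite lieC killingNl killing_invariant (coord_vbasis vW) killing_sumr big1 ?oppr0 // => i _.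
  rewrite killingZr killingC.
  have /(map_f (@killing_form _ S))/k0 : (vbasis W)`_i \in vbasis W by rewrite mem_nth ?size_tuple.
  by rewrite memv_ker killing_formE => /eqP->; rewrite mulr0.
have szE : size fs = \dim W by rewrite size_map size_tuple.
rewrite -(leq_add2l (\dim (kk :&: lker (ad x)))) limg_ker_dim.
by apply: leq_trans (dim_forms kk fs) _; rewrite szE leq_add2r; apply: dimvS sub.
Qed.

(** The map ad x has on k a rank at most dim [x, p], and ad y maps the kernel of ad x in k into
    its kernel in p. *)
Lemma dim_kk_cent x y : x \in pp -> y \in pp -> lie x y = 0 ->
  (\dim kk <= \dim (kk_cent x y) + \dim pp)%N.
Proof.
move=> xp yp xy.
have := limg_ker_dim (ad x) kk; have := limg_ker_dim (ad x) pp.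
have := limg_ker_dim (ad y) (kk :&: lker (ad x)).
have : (\dim (ad y @: (kk :&: lker (ad x))) <= \dim (pp :&: lker (ad x)))%N.
  apply/dimvS/subvP => _ /memv_imgP[k /memv_capP[kk' xk] ->].
  rewrite memv_cap -/(lie y k) lieC memvN lie_kk_pp //= memv_ker linearN oppr_eq0 /=.
  move: xk; rewrite memv_ker -!/(lie _ _) lie_jac => /eqP->.
  by rewrite xy lie0l lie0r addr0.
by have := dim_ad_kk_pp xp; rewrite /kk_cent; lia.
Qed.

(** The index of a pair is at least minus the rank, so that rigidity is an upper bound on the
    dimension of the centralizer of the pair in k: it suffices that k contains a copy of p, here
    the image of Phi, meeting this centralizer trivially. *)
Lemma rigid_criterion x y (Phi : 'End(S)) : x \in pp -> y \in pp -> lie x y = 0 ->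
  (forall v, v \in pp -> Phi v \in kk) ->
  (forall v, v \in pp -> lie x (Phi v) = 0 -> lie y (Phi v) = 0 -> v = 0) ->
  is_rigid x y.
Proof.
move=> xp yp xy Pk P0; split=> // a Ca.
have ker0 : (pp :&: lker Phi = 0)%VS.
  apply/eqP; rewrite -subv0; apply/subvP => v /memv_capP[vp].
  by rewrite memv_ker => /eqP v0; rewrite memv0 (P0 v) ?v0 ?lie0r.
have cap0 : (Phi @: pp :&: kk_cent x y = 0)%VS.
  apply/eqP; rewrite -subv0; apply/subvP => _ /memv_capP[/memv_imgP[v vp ->]].
  rewrite !memv_cap !memv_ker => /andP[/andP[_ /eqP xv] /eqP yv].
  by rewrite (P0 v) // linear0 mem0v.
have sub : (Phi @: pp + kk_cent x y <= kk)%VS.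
  rewrite subv_add; apply/andP; split; last by rewrite /kk_cent -capvA capvSl.
  by apply/subvP => _ /memv_imgP[v vp ->]; apply: Pk.
have := dimvS sub; rewrite dimv_disjoint_sum // limg_dim_eq //.
have := dim_kk_cent xp yp xy; have := cartan_dim Ca.
by rewrite /pair_index; lia.
Qed.

End CartanSub.

Section Model.
Variables (K : closedFieldType) (charK0 : [pchar K] =i pred0).

Lemma model_criterion (S : symLieAlg K) (M : pairModel K) (X Y : amb M) (Phi : amb M -> amb M) :
  isomorphic_to S M -> linear Phi ->
  mem_model X -> mem_model Y -> mtheta X = - X -> mtheta Y = - Y -> mbr X Y = 0 -> X != 0 ->
  (forall v : amb M, mem_model v -> mtheta v = - v ->
     [/\ mem_model (Phi v), mtheta (Phi v) = Phi v &
         mbr X (Phi v) = 0 -> mbr Y (Phi v) = 0 -> v = 0]) ->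
  has_nontrivial_rigid_pair S.
Proof.
case=> f [finj fmem flie ftheta] linPhi memX memY tX tY XY X0 PhiP.
have [x fx] := proj1 (fmem _) memX; have [y fy] := proj1 (fmem _) memY.
pose LPhi : {linear amb M -> amb M} := HB.pack Phi (GRing.isLinear.Build K _ _ _ Phi linPhi).
pose F : 'End(S) := (f^-1 \o linfun LPhi \o f)%VF.
have fK : cancel f f^-1%VF by apply: lker0_lfunK; apply/lker0P.
have inpp u : mtheta (f u) = - f u <-> u \in pp S.
  rewrite mem_pp -ftheta -linearN; split=> [/finj/eqP //|/eqP->//].
have fF v : v \in pp S -> f (F v) = Phi (f v).
  move=> /inpp tv; have [|memPhi _ _] := PhiP (f v) _ tv; first by apply/fmem; exists v.
  have [w fw] := proj1 (fmem _) memPhi.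
  by rewrite !comp_lfunE lfunE /= -fw fK.
exists x, y; split; last first.
  by case=> _ x0 _; rewrite -fx x0 linear0 eqxx in X0.
apply: (rigid_criterion charK0 (Phi := F)).
- by apply/inpp; rewrite fx.
- by apply/inpp; rewrite fy.
- by apply: finj; rewrite flie fx fy XY linear0.
- move=> v vp; rewrite mem_kk; apply/eqP/finj; rewrite ftheta fF //.
  have [|_ -> _ //] := PhiP (f v) _ (proj2 (inpp v) vp); by apply/fmem; exists v.
- move=> v vp xv yv; apply: finj; rewrite linear0.
  have [|_ _] := PhiP (f v) _ (proj2 (inpp v) vp); first by apply/fmem; exists v.
  by apply; rewrite -fF // -?fx -?fy -flie ?xv ?yv linear0.
Qed.

End Model.

(** * Pairs of rank-one type: AIII and CII *)

Section Block.
Variable K : fieldType.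

Lemma sign_mx_conj m n (a : 'M[K]_m) b c (d : 'M[K]_n) :
  sign_mx K m n *m block_mx a b c d *m sign_mx K m n = block_mx a (- b) (- c) d.
Proof.
rewrite /sign_mx !mulmx_block !mul1mx !mul0mx !mulmx0 !mulmx1 ?mulNmx ?mulmxN !mul1mx !mulmx1.
by rewrite !addr0 !add0r opprK.
Qed.

Lemma sign_mx_odd m n (charK0 : [pchar K] =i pred0) (v : 'M[K]_(m + n)) :
  sign_mx K m n *m v *m sign_mx K m n = - v ->
  v = block_mx 0 (ursubmx v) (dlsubmx v) 0.
Proof.
have := sign_mx_conj (ulsubmx v) (ursubmx v) (dlsubmx v) (drsubmx v); rewrite submxK => ->.
rewrite -[X in _ = - X]submxK opp_block_mx => /eq_block_mx[a0 _ _ d0].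
have neg0 p (A : 'M[K]_p) : A = - A -> A = 0.
  move=> AA; apply/eqP; have : 2%:R *: A == 0 by rewrite scaler_nat mulr2n {1}AA addNr.
  by rewrite scaler_eq0 natr_char0.
by rewrite -[LHS]submxK (neg0 _ _ a0) (neg0 _ _ d0).
Qed.

Lemma ursubmx_linear m1 m2 n1 n2 : linear (@ursubmx K m1 m2 n1 n2).
Proof. by move=> c u v; apply/matrixP => i j; rewrite !mxE. Qed.

Lemma dlsubmx_linear m1 m2 n1 n2 : linear (@dlsubmx K m1 m2 n1 n2).
Proof. by move=> c u v; apply/matrixP => i j; rewrite !mxE. Qed.

End Block.

Section AIII.
Variables (K : closedFieldType) (charK0 : [pchar K] =i pred0).

(** The space p is that of pairs of a column and a row of length p, and X, Y are the first two
    basic columns e0 and e1. The bracket of X with diag(M - t, - t) is the column - M e0, and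
    likewise for Y, so Phi v need only encode the column of v in M e0 and its row in M e1. *)
Lemma AIII_rigid p (S : symLieAlg K) : (2 <= p)%N -> isomorphic_to S (AIII K p 1) ->
  has_nontrivial_rigid_pair S.
Proof.
case: p => [|[|p]] // _ iso.
pose q := p.+2; pose i0 : 'I_q := ord0; pose i1 : 'I_q := lift ord0 ord0.
pose e (i : 'I_q) : 'M[K]_(q, 1) := delta_mx i 0.
pose E (w : 'M[K]_(q, 1)) : 'M[K]_(q + 1) := block_mx 0 w 0 0.
pose N (v : 'M[K]_(q + 1)) : 'M[K]_q :=
  ursubmx v *m delta_mx 0 i0 + (dlsubmx v)^T *m delta_mx 0 i1.
(* The scalar t makes Phi v traceless. *)
pose t v : K := \tr (N v) / q.+1%:R.
pose Phi v : 'M[K]_(q + 1) := block_mx (N v - (t v)%:M) 0 0 (- (t v)%:M).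
have linN : linear N.
  by move=> c u v; rewrite /N ursubmx_linear dlsubmx_linear linearP /= !mulmxDl -!scalemxAl
    scalerDr addrACA.
have lint : linear (t : _ -> K^o).
  by move=> c u v; rewrite /t linN mxtraceD mxtraceZ mulrDl -mulrA.
have EPhi w v : E w *m Phi v - Phi v *m E w = E (- (N v *m w)).
  rewrite /E /Phi !mulmx_block !mul0mx !mulmx0 !add0r !addr0 mulmxN mul_mx_scalar.
  rewrite mulmxBl mul_scalar_mx opp_block_mx add_block_mx ?subr0 ?oppr0 ?addr0 opprB addrA.
  by rewrite addNr add0r.
have q0 : q.+1%:R != 0 :> K by rewrite natr_char0.
have trE w : \tr (E w) = 0 by rewrite mxtrace_block !mxtrace0 addr0.
have tE w : mtheta (E w : amb (AIII K q 1)) = - E w.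
  by rewrite /= sign_mx_conj /E opp_block_mx !oppr0.
apply: (@model_criterion _ charK0 S (AIII K q 1) (E (e i0)) (E (e i1)) Phi) => //.
- move=> c u v; rewrite /Phi linN lint.
  have tE' n : (c *: (t u : K^o) + t v)%:M = c *: (t u)%:M + (t v)%:M :> 'M[K]_n.
    by rewrite raddfD /= -scale_scalar_mx.
  rewrite !tE' scale_block_mx add_block_mx !scaler0 !addr0 scalerBr opprD addrACA.
  by rewrite [in RHS]scalerN opprD.
- by rewrite /= /E !mulmx_block !mul0mx !mulmx0 !addr0 subrr.
- apply/eqP => /(congr1 (fun A : 'M_(q + 1) => A (lshift 1 i0) (rshift q 0))) /eqP.
  by rewrite block_mxEur !mxE !eqxx oner_eq0.
move=> v _ /(sign_mx_odd charK0) vE; split.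
- rewrite /= mxtrace_block linearB linearN /= !mxtrace_scalar /t -addrA -opprD.
  by rewrite -mulrnDr addn1 -[X in _ - X]mulr_natr divfK // subrr.
- by rewrite /= sign_mx_conj !oppr0.
have Nw w : E w *m Phi v - Phi v *m E w = 0 -> N v *m w = 0.
  rewrite EPhi -(block_mx0 K q 1 q 1) => /eq_block_mx[_ /eqP + _ _].
  by rewrite oppr_eq0 => /eqP.
have ee i j : (delta_mx 0 i : 'M[K]_(1, q)) *m e j = (i == j)%:R%:M.
  rewrite mul_delta_mx_cond; apply/matrixP => a b; rewrite !ord1.
  by case: (i == j); rewrite ?mulr1n ?mulr0n !mxE ?eqxx ?mul0rn /=.
move=> /Nw; rewrite /N mulmxDl -!mulmxA !ee /= mul_mx_scalar scale1r mul_mx_scalar scale0r addr0 =>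
  B0.
move=> /Nw; rewrite /N mulmxDl -!mulmxA !ee /= !mul_mx_scalar scale1r scale0r add0r => C0.
by rewrite vE B0 -(trmxK (dlsubmx v)) C0 trmx0 -[LHS]/(block_mx 0 0 0 0) block_mx0.
Qed.

End AIII.

Section CII.
Variables (K : closedFieldType) (charK0 : [pchar K] =i pred0).
Local Notation J := (symplectic_form K).

Lemma symplectic_formT m : (J m)^T = - J m.
Proof. by rewrite /symplectic_form tr_block_mx opp_block_mx !trmx0 linearN /= trmx1 !oppr0 opprK.
  Qed.

Lemma symplectic_form_sq m : J m *m J m = - 1%:M.
Proof.
rewrite /symplectic_form mulmx_block !mul0mx !mulmx0 !mulmxN !mulNmx !mul1mx !add0r !addr0 ?oppr0.
by rewrite [in RHS](scalar_mx_block m m) opp_block_mx !oppr0.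
Qed.

(** The element of p with upper right block B, its lower left block being determined by the
    symplectic forms. *)
Definition cii p B : 'M[K]_((p + p) + (1 + 1)) := block_mx 0 B (J 1 *m B^T *m J p) 0.

Lemma cii_mem p (A : 'M[K]_(p + p)) B C (D : 'M[K]_(1 + 1)) :
  mem_model (block_mx A B C D : amb (CII K p 1)) <->
  [/\ A^T *m J p + J p *m A = 0, C^T *m J 1 + J p *m B = 0,
      B^T *m J p + J 1 *m C = 0 & D^T *m J 1 + J 1 *m D = 0].
Proof.
rewrite /= tr_block_mx !mulmx_block !mulmx0 !mul0mx !addr0 !add0r add_block_mx.
rewrite -(block_mx0 K (p + p) (1 + 1) (p + p) (1 + 1)).
by split=> [/eq_block_mx //|[-> -> -> ->]].
Qed.

(** The space p is Hom(K^2, K^2p), and X, Y send the first basis vector of K^2 to the vectors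
    w0, w1 of a Lagrangian subspace and the second one to 0. An element (A, D) of k with D
    strictly upper triangular commutes with X if and only if A w0 = 0 and D = 0. The 4p
    coordinates of v are encoded in A w0 and A w1, except one: the symmetry of the block c of A
    forces two entries to coincide, and D carries the coordinate that is lost. *)
Lemma CII_1_rigid p (S : symLieAlg K) : (2 <= p)%N -> isomorphic_to S (CII K p 1) ->
  has_nontrivial_rigid_pair S.
Proof.
case: p => [|[|p]] // _ iso; set q := p.+2 in iso *.
pose i0 : 'I_q := ord0; pose i1 : 'I_q := lift ord0 ord0.
pose c0 : 'I_(1 + 1) := lshift 1 0; pose c1 : 'I_(1 + 1) := rshift 1 0.
pose w (i : 'I_q) : 'cV[K]_(q + q) := col_mx (delta_mx i 0) 0.
pose X (i : 'I_q) : 'M[K]_((q + q) + (1 + 1)) := cii (row_mx (w i) 0).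
pose Bu (v : 'M[K]_((q + q) + (1 + 1))) := usubmx (ursubmx v).
pose Bd (v : 'M[K]_((q + q) + (1 + 1))) := dsubmx (ursubmx v).
pose a v : 'M[K]_q := \matrix_(i, j)
  (if j == i0 then Bu v i c0 else if j == i1 then Bu v i c1 else 0).
pose c v : 'M[K]_q := \matrix_(i, j)
  (if j == i0 then Bd v i c0 else if i == i0 then Bd v j c0 else
   if j == i1 then Bd v i c1 else if i == i1 then Bd v j c1 else 0).
pose A v := block_mx (a v) 0 (c v) (- (a v)^T).
pose D v : 'M[K]_(1 + 1) := block_mx 0 (Bd v i0 c1)%:M 0 0.
pose Phi v : 'M[K]_((q + q) + (1 + 1)) := block_mx (A v) 0 0 (D v).
have mem_X i : mem_model (X i : amb (CII K q 1)).
  apply/cii_mem; move: (row_mx _ _) => B; split.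
  - by rewrite trmx0 mul0mx mulmx0 addr0.
  - rewrite !trmx_mul trmxK !symplectic_formT !(mulmxN, mulNmx) opprK -!mulmxA.
    by rewrite symplectic_form_sq !mulmxN mulmx1 addNr.
  - by rewrite !mulmxA symplectic_form_sq mulNmx mul1mx mulNmx subrr.
  - by rewrite trmx0 mul0mx mulmx0 addr0.
have theta_X i : mtheta (X i : amb (CII K q 1)) = - X i.
  by rewrite /= /X /cii sign_mx_conj opp_block_mx !oppr0.
have wJw i j : (w i)^T *m J q *m w j = 0.
  rewrite /w tr_col_mx trmx0 /symplectic_form mul_row_block !mul0mx !mulmx0 !addr0.
  by rewrite mul_row_col mul0mx mulmx0 addr0.
have XX i j : mbr (X i : amb (CII K q 1)) (X j) = 0.
  rewrite /= /X /cii !mulmx_block !mul0mx !mulmx0 !addr0 !add0r.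
  rewrite opp_block_mx add_block_mx !oppr0 !addr0.
  have ul k l : row_mx (w k) 0 *m (J 1 *m (row_mx (w l) 0)^T *m J q) = 0 :> 'M[K]_(q + q).
    rewrite tr_row_mx trmx0 /symplectic_form mul_block_col !mul0mx !mulmx0 !addr0 !mulmxA.
    by rewrite mul_row_col mul0mx mulmx0 add0r mul0mx.
  have dr k l : J 1 *m (row_mx (w k) 0)^T *m J q *m row_mx (w l) 0 = 0.
    rewrite tr_row_mx trmx0 -!mulmxA mul_mx_row mulmx0.
    by rewrite (mul_col_mx (w k)^T) mul0mx mul_mx_row mulmx0 mulmxA wJw row_mx0 col_mx0 mulmx0.
  by rewrite !ul !dr !subr0 block_mx0.
apply: (@model_criterion _ charK0 S (CII K q 1) (X i0) (X i1) Phi) => //.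
- move=> k u v; rewrite /Phi /A /D.
  have dE i j : Bd (k *: u + v) i j = k * Bd u i j + Bd v i j by rewrite !mxE.
  have aE : a (k *: u + v) = k *: a u + a v.
    by apply/matrixP => i j; rewrite !mxE; do 2?[case: ifP => _]; rewrite ?mulr0 ?addr0.
  have cE : c (k *: u + v) = k *: c u + c v.
    by apply/matrixP => i j; rewrite !mxE; do 4?[case: ifP => _]; rewrite ?mulr0 ?addr0.
  have sE x y : (k * x + y)%:M = k *: x%:M + y%:M :> 'M[K]_1.
    by rewrite raddfD /= -scale_scalar_mx.
  have aTE : (a (k *: u + v))^T = k *: (a u)^T + (a v)^T by rewrite aE linearP.
  rewrite aTE aE cE dE sE.
  by rewrite !(scale_block_mx, add_block_mx) !scaler0 !addr0 opprD -scalerN.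
- by apply/eqP => /(congr1 (fun A : 'M_((q + q) + (1 + 1)) => A (lshift _ (lshift q i0)) (rshift _
  (lshift 1 0)))) /eqP;
  rewrite /X /cii block_mxEur row_mxEl col_mxEu !mxE !eqxx oner_eq0.
move=> v memv /(sign_mx_odd charK0) vE; split.
- apply/cii_mem; rewrite !trmx0 !mul0mx !mulmx0 !addr0; split=> //.
    rewrite /A tr_block_mx /symplectic_form !mulmx_block !mul0mx !mulmx0 !mulmx1 !mul1mx.
    rewrite !mulmxN !mulNmx !mulmx1 !mul1mx trmx0 linearN /= trmxK !addr0 !add0r.
    rewrite ?oppr0 opprK add_block_mx ?addr0 ?add0r ?addNr ?subrr.
    have -> : (c v)^T = c v.
      apply/matrixP => i j; rewrite !mxE.
      case: (eqVneq i i0) => ei; case: (eqVneq j i0) => ej; rewrite ?ei ?ej //.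
      by case: (eqVneq i i1) => ei1; case: (eqVneq j i1) => ej1; rewrite ?ei1 ?ej1.
    by rewrite addNr block_mx0.
  rewrite /D tr_block_mx tr_scalar_mx !trmx0 /symplectic_form !mulmx_block !(mul0mx, mulmx0).
  rewrite mulNmx mul1mx mulmx1 add_block_mx !(addr0, add0r).
  by rewrite subrr block_mx0.
- by rewrite /= /Phi sign_mx_conj !oppr0.
have XPhi i : mbr (X i : amb (CII K q 1)) (Phi v) = 0 ->
    [/\ A v *m w i = 0 & Bd v i0 c1 = 0].
  rewrite /= /X /cii /Phi !mulmx_block !mul0mx !mulmx0 !addr0 !add0r.
  rewrite opp_block_mx add_block_mx -(block_mx0 K (q + q) (1 + 1) (q + q) (1 + 1)).
  move=> /eq_block_mx[_ + _ _].
  rewrite /D mul_row_block !mul0mx !mulmx0 !addr0 mul_mx_scalar mul_mx_row mulmx0.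
  rewrite opp_row_mx add_row_mx oppr0 addr0 sub0r -row_mx0 => /eq_row_mx[/eqP].
  rewrite oppr_eq0 => /eqP Aw /(congr1 (fun A : 'cV_(q + q) => A (lshift q i) 0)).
  by rewrite /w mxE (col_mxEu (delta_mx i 0)) !mxE !eqxx mulr1.
have Aw i : A v *m w i = 0 -> a v *m delta_mx i 0 = 0 :> 'cV_q /\ c v *m delta_mx i 0 = 0 :> 'cV_q.
  rewrite /A /w mul_block_col !mulmx0 !addr0 -(col_mx0 K q q 1).
  by move=> /eq_col_mx[-> ->].
have col0 (M : 'M[K]_q) i k : M *m delta_mx i 0 = 0 :> 'cV_q -> M k i = 0.
  by rewrite -colE => /(congr1 (fun z : 'cV_q => z k 0)); rewrite !mxE.
move=> /XPhi[/Aw[a0 c0'] d0] /XPhi[/Aw[a1 c1'] _].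
have B0 : ursubmx v = 0.
  have Bu0 i j : Bu v i j = 0.
    case: (split_ordP j) => k ->; rewrite (ord1 k).
      by have := col0 _ _ i a0; rewrite mxE eqxx.
    by have := col0 _ _ i a1; rewrite mxE.
  have Bd0 i j : Bd v i j = 0.
    case: (split_ordP j) => k ->; rewrite (ord1 k).
      by have := col0 _ _ i c0'; rewrite mxE eqxx.
    have [->|ni] := eqVneq i i0; first exact: d0.
    by have := col0 _ _ i c1'; rewrite mxE (negPf ni).
  apply/matrixP => i j; rewrite [RHS]mxE; case: (split_ordP i) => k ->.
    by rewrite -[RHS](Bu0 k j) /Bu [RHS]mxE.
  by rewrite -[RHS](Bd0 k j) /Bd [RHS]mxE.
have C0 : dlsubmx v = 0.
  have [_ _ + _] := (cii_mem _ _ _ _).1 (eq_ind _ (fun z => mem_model (z :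
    amb (CII K q 1))) memv _ vE).
  rewrite B0 trmx0 mul0mx add0r => /(congr1 (mulmx (J 1))).
  by rewrite mulmxA symplectic_form_sq mulNmx mul1mx mulmx0 => /eqP; rewrite oppr_eq0 => /eqP.
by rewrite vE B0 C0 block_mx0.
Qed.

End CII.

(** * Sparse linear systems *)

Section Forms.
Variables (U : eqType).

Definition form := seq (int * U).
Definition fscale (c : int) (f : form) : form :=
  if c == 0 then [::] else [seq (c * t.1, t.2) | t <- f].
Definition fcoef (f : form) (u : U) : int :=
  foldr (fun t s => if t.2 == u then t.1 + s else s) 0 f.
Definition fsupp (f : form) : seq U := [seq u <- undup [seq t.2 | t <- f] | fcoef f u != 0].
Definition fzero (f : form) : bool := nilp (fsupp f).

(** An equation with a single unknown not yet known to vanish makes it vanish. *)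
Definition eliminate (Z : seq U) (f : form) : seq U :=
  if [seq u <- fsupp f | u \notin Z] is [:: u] then u :: Z else Z.
(** This is Gaussian elimination restricted to systems that can be solved one unknown at a time;
    it only manipulates lists of unknowns, and it is sound over every field of characteristic 0.
    *)
Definition eliminate_all (fs : seq form) (rounds : nat) : seq U :=
  iter rounds (fun Z => foldl eliminate Z fs) [::].

Variables (K : fieldType) (charK0 : [pchar K] =i pred0).
Implicit Types env : U -> K.

Definition feval env (f : form) : K := \sum_(t <- f) t.1%:~R * env t.2.

Lemma feval_cat env f g : feval env (f ++ g) = feval env f + feval env g.
Proof. by rewrite /feval big_cat. Qed.

Lemma feval_scale env c f : feval env (fscale c f) = c%:~R * feval env f.
Proof.
rewrite /feval /fscale; case: eqP => [->|_]; first by rewrite big_nil mul0r.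
by rewrite big_map big_distrr; apply: eq_bigr => t _; rewrite rmorphM /= mulrA.
Qed.

Lemma feval_flatten env (I : Type) (r : seq I) (F : I -> form) :
  feval env (flatten [seq F i | i <- r]) = \sum_(i <- r) feval env (F i).
Proof.
elim: r => [|i r IHr]; first by rewrite big_nil /feval big_nil.
by rewrite /= feval_cat IHr big_cons.
Qed.

Lemma feval_coef env f : feval env f = \sum_(u <- undup [seq t.2 | t <- f]) (fcoef f u)%:~R * env u.
Proof.
suff main (s : seq U) : uniq s -> {subset [seq t.2 | t <- f] <= s} ->
    feval env f = \sum_(u <- s) (fcoef f u)%:~R * env u.
  by apply: main; rewrite ?undup_uniq // => u; rewrite mem_undup.
move=> us; rewrite /feval; elim: f => [|t f IHf] sub.
  by rewrite big_nil big1 // => u _; rewrite mul0r.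
rewrite big_cons IHf => [|u uf]; last by rewrite sub // inE uf orbT.
have ts : t.2 \in s by rewrite sub // inE eqxx.
rewrite (bigD1_seq t.2) //= [RHS](bigD1_seq t.2) //= eqxx rmorphD mulrDl addrA; congr (_ + _).
by apply: eq_bigr => u /negPf ut; rewrite eq_sym ut.
Qed.

Lemma feval_supp env f : feval env f = \sum_(u <- fsupp f) (fcoef f u)%:~R * env u.
Proof.
rewrite feval_coef /fsupp big_filter [RHS]big_mkcond /=.
by apply: eq_bigr => u _; case: eqP => [->|//]; rewrite mul0r.
Qed.

Lemma feval_fzero env f : fzero f -> feval env f = 0.
Proof. by rewrite feval_supp /fzero => /nilP->; rewrite big_nil. Qed.

Lemma eliminate_sound env Z f : feval env f = 0 -> {in Z, forall u, env u = 0} ->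
  {in eliminate Z f, forall u, env u = 0}.
Proof.
move=> f0 Z0; rewrite /eliminate.
case E: [seq u <- fsupp f | u \notin Z] => [//|u [|//]] w.
rewrite inE => /predU1P[->|/Z0 //].
have uf : u \in [seq u <- fsupp f | u \notin Z] by rewrite E mem_head.
have cu : fcoef f u != 0 by move: uf; rewrite !mem_filter => /and3P[].
have : (fcoef f u)%:~R * env u = 0.
  rewrite -[RHS]f0 feval_supp (bigID (mem Z)) /= [X in _ = X + _]big1; last first.
    by move=> t /Z0->; rewrite mulr0.
  by rewrite add0r -big_filter E big_seq1.
by move/eqP; rewrite mulf_eq0 intr_char0 // (negPf cu) => /eqP.
Qed.

Lemma eliminate_all_sound env fs n : {in fs, forall f, feval env f = 0} ->
  {in eliminate_all fs n, forall u, env u = 0}.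
Proof.
move=> fs0; rewrite /eliminate_all; elim: n => //= n IHn.
elim: fs (iter n _ _) fs0 IHn => [|f fs1 IHfs] Z fs0 Z0 //=.
apply: IHfs => [g gfs|]; first by rewrite fs0 // inE gfs orbT.
by apply: eliminate_sound Z0; rewrite fs0 ?mem_head.
Qed.

End Forms.

(** * Certificates for matrix Lie algebras *)

Section MatrixCertificate.
Variable n : nat.
Local Notation int_fun := (nat -> nat -> int).
Local Notation form_fun := (nat -> nat -> form (nat * nat)%type).

Definition all_entries (P : nat -> nat -> bool) : bool :=
  all (fun i => all (P i) (iota 0 n)) (iota 0 n).
Definition list_entries (T : Type) (F : nat -> nat -> T) : seq T :=
  [seq F i j | i <- iota 0 n, j <- iota 0 n].

Definition imul (f g : int_fun) : int_fun :=
  fun i j => foldr (fun k s => f i k * g k j + s) 0 (iota 0 n).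
Definition fmull (f : int_fun) (F : form_fun) : form_fun :=
  fun i j => flatten [seq fscale (f i k) (F k j) | k <- iota 0 n & f i k != 0].
Definition fmulr (F : form_fun) (f : int_fun) : form_fun :=
  fun i j => flatten [seq fscale (f k j) (F i k) | k <- iota 0 n & f k j != 0].

Definition sparse_fun (l : seq (nat * nat * int)) : int_fun :=
  fun i j => foldr (fun t s => if (t.1.1 == i) && (t.1.2 == j) then t.2 + s else s) 0 l.

Definition table_form (tab : seq (nat * nat * (int * (nat * nat)))) : form_fun :=
  fun i j => [seq t.2 | t <- tab & (t.1.1 == i) && (t.1.2 == j)].

(** When q^2 = - e this is F - q^-1 F^T q, which is skew for q whatever F is, so that a table
    need only describe half of the matrix. *)
Definition skew_part (e : int) (q : int_fun) (F : form_fun) : form_fun :=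
  let G := fmull q (fmulr (fun i j => F j i) q) in
  fun i j => F i j ++ fscale e (G i j).

Definition coord_form : form_fun := fun i j => [:: (1, (i, j))].

Definition skew_eq (q : int_fun) (F : form_fun) : form_fun :=
  fun i j => fmulr (fun k l => F l k) q i j ++ fmull q F i j.
Definition conj_eq (e : int) (s : int_fun) (F : form_fun) : form_fun :=
  let G := fmulr (fmull s F) s in fun i j => G i j ++ fscale e (F i j).
Definition comm_eq (x : int_fun) (F : form_fun) : form_fun :=
  fun i j => fmull x F i j ++ fscale (-1) (fmulr F x i j).

(** Evaluates all entries once, for the sake of computation. *)
Definition tabulate (F : form_fun) : form_fun :=
  let T := [seq [seq F i j | j <- iota 0 n] | i <- iota 0 n] in
  fun i j => nth [::] (nth [::] T i) j.

(** A computable form of the criterion for rigidity: x and y are commuting elements of p, x is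
    not 0, F maps every v to an element of k, and the equations that say that v is in p and that
    F(v) commutes with x and y imply that v = 0. *)
Definition certificate (q s x y : int_fun) (F : form_fun) (rounds : nat) : bool :=
  [&& all_entries (fun i j => imul (fun k l => x l k) q i j + imul q x i j == 0),
      all_entries (fun i j => imul (fun k l => y l k) q i j + imul q y i j == 0),
      all_entries (fun i j => imul (imul s x) s i j == - x i j),
      all_entries (fun i j => imul (imul s y) s i j == - y i j),
      all_entries (fun i j => imul x y i j == imul y x i j),
      ~~ all_entries (fun i j => x i j == 0),
      all_entries (fun i j => fzero (skew_eq q F i j)),
      all_entries (fun i j => fzero (conj_eq (-1) s F i j)) &
      let eqs := list_entries (skew_eq q coord_form) ++ list_entries (conj_eq 1 s coord_form)
        ++ list_entries (comm_eq x F) ++ list_entries (comm_eq y F) in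
      let Z := eliminate_all eqs rounds in all_entries (fun i j => (i, j) \in Z)].

Variables (K : closedFieldType) (charK0 : [pchar K] =i pred0).

Definition imatrix (f : int_fun) : 'M[K]_n := \matrix_(i, j) (f i j)%:~R.
Definition fmatrix (env : nat * nat -> K) (F : form_fun) : 'M[K]_n := \matrix_(i,
  j) feval env (F i j).

Lemma all_entriesP (P : nat -> nat -> bool) : reflect (forall i j : 'I_n, P i j) (all_entries P).
Proof.
apply: (iffP allP) => [PP i j|PP i]; last first.
  rewrite mem_iota => /andP[_ ni]; apply/allP => j; rewrite mem_iota => /andP[_ nj].
  exact: (PP (Ordinal ni) (Ordinal nj)).
have /PP/allP : (i : nat) \in iota 0 n by rewrite mem_iota add0n ltn_ord.
by apply; rewrite mem_iota add0n ltn_ord.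
Qed.

Lemma imatrix_mul f g : imatrix f *m imatrix g = imatrix (imul f g).
Proof.
apply/matrixP => i j; rewrite !mxE /imul -[RHS]/((foldr _ _ _)%:~R).
under eq_bigr do rewrite !mxE.
rewrite -(big_mkord xpredT (fun k => (f i k)%:~R * (g k j)%:~R)) /index_iota subn0.
elim: (iota 0 n) => [|k r IHr]; first by rewrite big_nil.
by rewrite big_cons IHr /= rmorphD rmorphM.
Qed.

Lemma imatrix_tr f : (imatrix f)^T = imatrix (fun i j => f j i).
Proof. by apply/matrixP => i j; rewrite !mxE. Qed.

Lemma imatrix_fmull env f F : imatrix f *m fmatrix env F = fmatrix env (fmull f F).
Proof.
apply/matrixP => i j; rewrite !mxE /fmull feval_flatten.
under eq_bigr do rewrite !mxE.
rewrite -(big_mkord xpredT (fun k => (f i k)%:~R * feval env (F k j))) /index_iota subn0.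
rewrite big_filter [RHS]big_mkcond; apply: eq_bigr => k _; rewrite feval_scale.
by case: eqP => //= ->; rewrite mul0r.
Qed.

Lemma imatrix_fmulr env f F : fmatrix env F *m imatrix f = fmatrix env (fmulr F f).
Proof.
apply/matrixP => i j; rewrite !mxE /fmulr feval_flatten.
under eq_bigr do rewrite !mxE.
rewrite -(big_mkord xpredT (fun k => feval env (F i k) * (f k j)%:~R)) /index_iota subn0.
rewrite big_filter [RHS]big_mkcond; apply: eq_bigr => k _; rewrite feval_scale mulrC.
by case: eqP => //= ->; rewrite mul0r.
Qed.

Definition entry (v : 'M[K]_n) (ij : nat * nat) : K :=
  if (insub ij.1, insub ij.2) is (Some i, Some j) then v i j else 0.

Lemma entryE v (i j : 'I_n) : entry v (i : nat, j : nat) = v i j.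
Proof. by rewrite /entry /= !valK. Qed.

Lemma entry_linear ij : linear (entry^~ ij : 'M[K]_n -> K^o).
Proof.
move=> c u v; rewrite /entry; case: (insub _) => [i|]; last by rewrite scaler0 addr0.
by case: (insub _) => [j|]; rewrite ?mxE // scaler0 addr0.
Qed.

Lemma fmatrix_coord v : fmatrix (entry v) coord_form = v.
Proof. by apply/matrixP => i j; rewrite mxE /feval big_seq1 mul1r entryE. Qed.

Lemma certificate_rigid (q s x y : int_fun) F rounds (S : symLieAlg K) :
  certificate q s x y F rounds ->
  isomorphic_to S (mx_pair (fun A => A^T *m imatrix q + imatrix q *m A = 0) (imatrix s)) ->
  has_nontrivial_rigid_pair S.
Proof.
move=> /and5P[/all_entriesP qx /all_entriesP qy /all_entriesP sx /all_entriesP sy].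
move=> /and5P[/all_entriesP xy x0 /all_entriesP qF /all_entriesP sF /all_entriesP elim] iso.
pose Phi (v : 'M[K]_n) := fmatrix (entry v) F.
have skewX z : (forall i j : 'I_n, imul (fun k l => z l k) q i j + imul q z i j == 0) ->
    (imatrix z)^T *m imatrix q + imatrix q *m imatrix z = 0.
  move=> qz; rewrite imatrix_tr !imatrix_mul; apply/matrixP => i j; rewrite !mxE -rmorphD.
  by rewrite (eqP (qz i j)).
have conjX z : (forall i j : 'I_n, imul (imul s z) s i j == - z i j) ->
    imatrix s *m imatrix z *m imatrix s = - imatrix z.
  move=> sz; rewrite !imatrix_mul; apply/matrixP => i j; rewrite !mxE.
  by rewrite (eqP (sz i j)) rmorphN.
have skewF env G i j : ((fmatrix env G)^T *m imatrix q + imatrix q *m fmatrix env G) i j =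
    feval env (skew_eq q G i j).
  have -> : (fmatrix env G)^T = fmatrix env (fun i j => G j i).
    by apply/matrixP => k l; rewrite !mxE.
  by rewrite imatrix_fmulr imatrix_fmull /skew_eq feval_cat !mxE.
have conjF env G e i j : (imatrix s *m fmatrix env G *m imatrix s + e%:~R *: fmatrix env G) i j =
    feval env (conj_eq e s G i j).
  by rewrite imatrix_fmull imatrix_fmulr /conj_eq feval_cat feval_scale !mxE.
have commF env G z i j : (imatrix z *m fmatrix env G - fmatrix env G *m imatrix z) i j =
    feval env (comm_eq z G i j).
  by rewrite imatrix_fmull imatrix_fmulr /comm_eq feval_cat feval_scale !mxE mulN1r.
apply: (@model_criterion _ charK0 S
  (mx_pair (fun A : 'M[K]_n => A^T *m imatrix q + imatrix q *m A = 0) (imatrix s))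
  (imatrix x) (imatrix y) Phi iso).
- move=> c u v; apply/matrixP => i j; rewrite !mxE /feval.
  rewrite big_distrr -big_split /=; apply: eq_bigr => t _.
  by rewrite entry_linear mulrDr mulrCA.
- exact: skewX.
- exact: skewX.
- exact: conjX.
- exact: conjX.
- rewrite /= !imatrix_mul; apply/matrixP => i j; rewrite !mxE.
  by rewrite (eqP (xy i j)) subrr.
- apply: contra x0 => /eqP/matrixP X0; apply/all_entriesP => i j.
  by have := X0 i j; rewrite !mxE => /eqP; rewrite intr_char0.
move=> v /= memv conjv; split.
- by apply/matrixP => i j; rewrite skewF feval_fzero // mxE.
- apply/eqP; rewrite -subr_eq0 -scaleN1r -[-1]/((-1)%:~R); apply/eqP.
  by apply/matrixP => i j; rewrite conjF feval_fzero // mxE.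
move=> Xv Yv; apply/matrixP => i j; rewrite [RHS]mxE -entryE.
apply: (eliminate_all_sound charK0 _ (elim i j)) => f.
rewrite -(fmatrix_coord v) in memv conjv.
have eqs (G : form_fun) : (forall i j : 'I_n, feval (entry v) (G i j) = 0) ->
    f \in list_entries G -> feval (entry v) f = 0.
  move=> H /allpairsP[[k l] /= [+ + ->]]; rewrite !mem_iota !add0n => /andP[_ nk] /andP[_ nl].
  exact: (H (Ordinal nk) (Ordinal nl)).
rewrite !mem_cat => /or4P[]; apply: eqs => k l.
- by rewrite -skewF memv mxE.
- by rewrite -conjF conjv scale1r addNr mxE.
- by rewrite -commF; move/matrixP: Xv => ->; rewrite mxE.
- by rewrite -commF; move/matrixP: Yv => ->; rewrite mxE.
Qed.

End MatrixCertificate.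

(** * The pairs in so(12) and sp(12) *)

Definition sign66 (i j : nat) : int := if i == j then (if (i < 6)%N then 1 else -1) else 0.

Definition DIII_form (i j : nat) : int := if (j == i + 6)%N || (i == j + 6)%N then 1 else 0.
(** The space K^12 = W + W* is made into a module over K[s, t] / (s, t)^3 by letting W be the
    regular module, with even part spanned by 1, s^2, s t, t^2 and odd part by s, t. Here x and
    y are the multiplications by s and t, and the basis of W formed of 1; s, t; s^2, s t, t^2
    has indices 0; 10, 11; 1, 2, 3. *)
Definition DIII_x := sparse_fun
  [:: ((10, 0)%N, 1); ((1, 10)%N, 1); ((2, 11)%N, 1); ((6, 4)%N, -1); ((4, 7)%N, -1); ((5, 8)%N,
    -1)].
Definition DIII_y := sparse_fun
  [:: ((11, 0)%N, 1); ((3, 11)%N, 1); ((2, 10)%N, 1); ((6, 5)%N, -1); ((5, 9)%N, -1); ((4, 8)%N,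
    -1)].
(** The matrices in gl(6) vanishing outside of these positions form a complement of the
    centralizer of the pair, of dimension 6. *)
Definition DIII_positions : seq (nat * nat) :=
  [seq ij <- [seq (i, j) | i <- iota 0 6, j <- iota 0 6] |
    ((ij.2 != 0) || (ij.1 == 0)) && (ij != (3, 3))]%N.
(** An element of p consists of two skew-symmetric blocks, each given by the entries above its
    diagonal. *)
Definition DIII_coordinates : seq (nat * nat) :=
  [seq (ij.1, 6 + ij.2) | ij <- [seq (i, j) | i <- iota 0 6, j <- iota 0 6] & ij.1 < ij.2]%N ++
  [seq (6 + ij.1, ij.2) | ij <- [seq (i, j) | i <- iota 0 6, j <- iota 0 6] & ij.1 < ij.2]%N.
Definition DIII_table :=
  [seq (t.1, (1 : int, t.2)) | t <- zip DIII_positions DIII_coordinates].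

Lemma DIII_certificate :
  certificate 12 DIII_form sign66 DIII_x DIII_y
    (tabulate 12 (skew_part 12 (-1) DIII_form (tabulate 12 (table_form DIII_table)))) 8.
Proof. by vm_compute. Qed.

Definition CII_form (i j : nat) : int :=
  if ((i %/ 6 == j %/ 6) && (j == i + 3))%N then 1 else
  if ((i %/ 6 == j %/ 6) && (i == j + 3))%N then -1 else 0.
(** The pair makes K^12 a graded module G + K^2 (x) G + G* over K[s, t], where G = K^3 is
    spanned by the vectors with indices 1, 2, 3 and G* by 0, 4, 5. The bijective action of the
    span K^2 of s and t from G to the vectors with indices 6, ..., 11 identifies the latter with
    K^2 (x) G. The products s^2, s t, t^2 act from G to G* by skew forms, which form a basis of
    the skew forms on G. *)
Definition CII_x := sparse_fun
  [:: ((0, 11)%N, 1); ((8, 3)%N, 1); ((4, 10)%N, 1); ((7, 1)%N, -1); ((5, 8)%N, 1); ((11, 2)%N, 1)].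
Definition CII_y := sparse_fun
  [:: ((0, 6)%N, 1); ((9, 3)%N, -1); ((4, 9)%N, 1); ((6, 1)%N, -1); ((5, 7)%N, 1); ((10, 2)%N, 1);
    ((4, 11)%N, 1); ((8, 1)%N, -1)].
Definition CII_positions : seq (nat * nat) :=
  [:: (0, 0); (0, 4); (0, 5); (1, 0); (1, 1); (1, 2); (1, 4); (1, 5); (2, 0); (2, 1); (2, 2);
      (2, 5); (3, 0); (3, 1); (3, 2);
      (6, 6); (6, 7); (6, 8); (6, 9); (6, 10); (6, 11); (7, 6); (7, 7); (7, 8); (7, 10); (7, 11);
      (8, 6); (8, 7); (8, 8); (8, 11); (9, 6); (9, 7); (9, 8); (10, 7); (10, 8); (11, 8)]%N.
Definition CII_coordinates : seq (nat * nat) := [seq (i, j) | i <- iota 0 6, j <- iota 6 6].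
(** The coordinate (0, 10) is carried by a toral element of k instead of the matrix unit at (1,
    1): with this choice the system can be solved one unknown at a time. *)
Definition CII_table :=
  [seq (t.1, (1 : int, t.2)) | t <- zip CII_positions CII_coordinates] ++
  [:: ((0, 0)%N, (-1, (0, 10)%N)); ((2, 2)%N, (-1, (0, 10)%N));
      ((6, 6)%N, (1, (0, 10)%N)); ((7, 7)%N, (1, (0, 10)%N)); ((8, 8)%N, (1, (0, 10)%N))].

Lemma CII_certificate :
  certificate 12 CII_form sign66 CII_x CII_y
    (tabulate 12 (skew_part 12 1 CII_form (tabulate 12 (table_form CII_table)))) 8.
Proof. by vm_compute. Qed.

Section Instances.
Variables (K : closedFieldType) (charK0 : [pchar K] =i pred0).

Lemma imatrix_block m n (A : 'M[K]_m) (B : 'M[K]_(m, n)) (C : 'M[K]_(n, m)) (D : 'M[K]_n) (f :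
  nat -> nat -> int) :
  (forall i j, A i j = (f i j)%:~R) -> (forall i j, B i j = (f i (m + j)%N)%:~R) ->
  (forall i j, C i j = (f (m + i)%N j)%:~R) -> (forall i j, D i j = (f (m + i)%N (m + j)%N)%:~R) ->
  block_mx A B C D = imatrix (m + n) K f.
Proof.
move=> fA fB fC fD; apply/matrixP => i j; rewrite [RHS]mxE.
by case: (split_ordP i) => k ->; case: (split_ordP j) => l ->;
  rewrite ?block_mxEul ?block_mxEur ?block_mxEdl ?block_mxEdr /=.
Qed.

Lemma sign66E : sign_mx K 6 6 = imatrix 12 K sign66.
Proof.
apply: imatrix_block => i j; rewrite !mxE /sign66; have := ltn_ord i; have := ltn_ord j.
- by move=> _ ->; rewrite -val_eqE /=; case: eqP.
- by move=> ? ?; case: eqP => //; lia.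
- by move=> ? ?; case: eqP => //; lia.
- move=> ? ?; rewrite eqn_add2l -val_eqE /=; case: eqP => _; rewrite ?oppr0 //.
Qed.

Lemma DIII_formE : block_mx 0 1%:M 1%:M 0 = imatrix (6 + 6) K DIII_form.
Proof.
apply: imatrix_block => i j; rewrite !mxE /DIII_form; have := ltn_ord i; have := ltn_ord j => *.
- by case: ifP => //; lia.
- by rewrite -val_eqE /=; case: eqP => ?; case: ifP => //; lia.
- by rewrite -val_eqE /=; case: eqP => ?; case: ifP => //; lia.
- by case: ifP => //; lia.
Qed.

Lemma symplectic_formE : symplectic_form K 3 = imatrix (3 + 3) K CII_form.
Proof.
apply: imatrix_block => i j; rewrite !mxE /CII_form; have := ltn_ord i; have := ltn_ord j => *.
- by do 2?[case: ifP => //]; lia.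
- by rewrite -val_eqE /=; case: eqP => ?; do 2?[case: ifP => //]; lia.
- by rewrite -val_eqE /=; case: eqP => ?; do 2?[case: ifP => //]; rewrite ?oppr0 //; lia.
- by do 2?[case: ifP => //]; lia.
Qed.

Lemma CII_formE : block_mx (symplectic_form K 3) 0 0 (symplectic_form K 3) =
  imatrix ((3 + 3) + (3 + 3)) K CII_form.
Proof.
rewrite symplectic_formE.
apply: imatrix_block => i j; rewrite !mxE /CII_form; have := ltn_ord i; have := ltn_ord j => *.
- by [].
- by do 2?[case: ifP => //]; lia.
- by do 2?[case: ifP => //]; lia.
- by congr _%:~R; do 2?[case: ifP]; do 2?[case: ifP]; lia.
Qed.

Lemma DIII_6_rigid (S : symLieAlg K) : isomorphic_to S (DIII K 6) -> has_nontrivial_rigid_pair S.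
Proof.
by rewrite /DIII sign66E DIII_formE; apply: certificate_rigid DIII_certificate.
Qed.

Lemma CII_3_rigid (S : symLieAlg K) : isomorphic_to S (CII K 3 3) -> has_nontrivial_rigid_pair S.
Proof.
by rewrite /CII sign66E CII_formE; apply: certificate_rigid CII_certificate.
Qed.

End Instances.

(** * Certificates for simply laced Lie algebras *)

Section RootCertificate.
Variables (n : nat) (edges : seq (nat * nat)).
Implicit Types a b c : seq int.

(** A sum that computes, the big operators being opaque. *)
Definition sum_list (T : Type) (F : T -> int) (r : seq T) : int := foldr (fun t s => F t + s) 0 r.

Lemma sum_listE (T : Type) (F : T -> int) r : \sum_(t <- r) F t = sum_list F r.
Proof. by elim: r => [|t r IHr]; rewrite ?big_nil // big_cons IHr. Qed.

Definition euler a b : int :=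
  sum_list (fun i => a`_i * b`_i) (iota 0 n) - sum_list (fun e => a`_e.1 * b`_e.2) edges.
Definition inner a b : int := euler a b + euler b a.
Definition reflect i a : seq int :=
  mkseq (fun j => a`_j - inner a (simple_root n i) * (i == j)%:R) n.

Lemma eulerE a b : euler_form n edges a b = euler a b.
Proof.
rewrite /euler_form /euler -!sum_listE; congr (_ - _).
by rewrite -(big_mkord xpredT (fun i => a`_i * b`_i)) /index_iota subn0.
Qed.

Lemma innerE a b : root_form n edges a b = inner a b.
Proof. by rewrite /root_form !eulerE. Qed.

Lemma reflectE i a : reflection n edges i a = reflect i a.
Proof. by rewrite /reflection innerE. Qed.

(** Breadth-first search: only the roots found in the last round are reflected again. *)
Fixpoint orbit_search (k : nat) (seen front : seq (seq int)) : seq (seq int) :=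
  if k is k'.+1 then
    let new := undup [seq b <- [seq reflect i a | a <- front, i <- iota 0 n] | b \notin seen] in
    orbit_search k' (seen ++ new) new
  else seen.

Definition simple_roots : seq (seq int) := [seq simple_root n i | i <- iota 0 n].
Definition root_list : seq (seq int) := orbit_search 20 simple_roots simple_roots.

Definition root_list_ok (r : seq (seq int)) : bool :=
  [&& all (mem r) simple_roots,
      all (fun a => size a == n) r &
      all (fun a => all (fun i => reflect i a \in r) (iota 0 n)) r].

Lemma orbit_search_sound k m seen front :
  {subset seen <= iter m (root_step n edges) simple_roots} ->
  {subset front <= iter m (root_step n edges) simple_roots} ->
  {subset orbit_search k seen front <= iter (k + m) (root_step n edges) simple_roots}.
Proof.
elim: k m seen front => [//|k IHk] m seen front sseen sfront.
rewrite addSnnS [orbit_search _ _ _]/=; set new := undup _.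
have mono : {subset iter m (root_step n edges) simple_roots <= iter m.+1 (root_step n edges)
  simple_roots}.
  by move=> a am; rewrite iterS /root_step mem_undup mem_cat am.
have snew : {subset new <= iter m.+1 (root_step n edges) simple_roots}.
  move=> b; rewrite mem_undup mem_filter => /andP[_ /allpairsP[[a i] /= [af i_n ->]]].
  rewrite /root_step mem_undup mem_cat; apply/orP; right.
  by apply/allpairsP; exists (a, i); rewrite sfront //= -reflectE.
apply: IHk => // a.
by rewrite mem_cat => /orP[/sseen/mono|/snew].
Qed.

(** A list closed under reflections contains all iterates, whatever their number. *)
Lemma root_list_closed r k : root_list_ok r ->
  {subset iter k (root_step n edges) simple_roots <= r}.
Proof.
move=> /and3P[/allP simp _ /allP closed].
elim: k => [|k IHk] a; first by move=> /simp.
rewrite iterS /root_step mem_undup mem_cat => /orP[/IHk //|/allpairsP[[b i] /= [/IHk br i_n ->]]].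
by rewrite reflectE; have /allP := closed b br; apply.
Qed.

Lemma orbit_search_sub k : {subset orbit_search k simple_roots simple_roots <=
  iter k (root_step n edges) simple_roots}.
Proof. by have := @orbit_search_sound k 0 simple_roots simple_roots; rewrite addn0; apply. Qed.

Lemma rootsE_iter : Defs.roots n edges = iter 20 (root_step n edges) simple_roots.
Proof. reflexivity. Qed.

(* From here on the roots are only accessed through membership in the computed list; the
   twenty quadratic steps of their definition must not be unfolded. *)
Opaque Defs.roots.

Lemma mem_roots : root_list_ok root_list -> Defs.roots n edges =i root_list.
Proof.
move=> ok a; rewrite rootsE_iter; apply/idP/idP.
  by apply: (@root_list_closed root_list).
by apply: orbit_search_sub.
Qed.

Definition lat_sub a b : seq int := mkseq (fun i => a`_i - b`_i) n.

Lemma lat_subP a b c : size b = n -> size c = n -> (lat_add n a b == c) = (b == lat_sub c a).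
Proof.
move=> sb sc; apply/eqP/eqP => [<-|->].
  apply: (@eq_from_nth _ 0); rewrite ?size_mkseq // sb => i i_n.
  by rewrite !nth_mkseq // addrC addKr.
apply: (@eq_from_nth _ 0); rewrite ?size_mkseq // => i i_n.
by rewrite !nth_mkseq // addrC subrK.
Qed.

Definition sgn_parity (z : int) : int := if odd `|z|%N then -1 else 1.

Local Notation coord_form := (nat + seq int -> form (nat + seq int)%type).

Definition parity (nodes : seq nat) a : int := sgn_parity (sum_list (fun i => a`_i) nodes).

(** The coefficient at e_c of the bracket of x with F(v): the terms of x at roots a meet the
    coefficients of F(v) at c - a, and its term at c meets the toral part of F(v). Unknowns are
    toral coordinates [inl i] and root coordinates [inr a]. *)
Definition bracket_form (r : seq (seq int)) (xs : seq (int * seq int)) (F : coord_form) c :=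
  flatten [seq (if lat_sub c t.2 \in r
                then fscale (t.1 * sgn_parity (euler t.2 (lat_sub c t.2))) (F (inr (lat_sub c t.2)))
                else [::]) | t <- xs] ++
  fscale (- fcoef xs c) (flatten [seq fscale (inner (simple_root n i) c) (F (inl i)) | i <- iota 0
    n]).

(** The analogue of the certificate for matrices. The list [extra] holds equations satisfied by
    all elements of the model, and the factors 2 and parity + 1 express that v is odd under the
    involution. No root of y is the opposite of a root of x, so that [x, y] has no toral part.
    *)
Definition root_certificate (nodes : seq nat) (extra : seq (form (nat + seq int)%type))
    (xs ys : seq (int * seq int)) (F : coord_form) (rounds : nat) : bool :=
  let r := root_list in
  [&& root_list_ok r, all (mem r) [seq t.2 | t <- xs], all (mem r) [seq t.2 | t <- ys],
      all (fun t => parity nodes t.2 == -1) (xs ++ ys) & 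
  [&& has (fun a => fcoef xs a != 0) r,
      all (fun c => sum_list (fun t => t.1 * sgn_parity (euler t.2 (lat_sub c t.2)) *
                       fcoef ys (lat_sub c t.2)) xs == 0) r,
      all (fun t => fcoef ys (lat_sub (lat_zero n) t.2) == 0) xs,
      all (fun c => (parity nodes c == 1) || fzero (F (inr c))) r &
      let eqs := extra ++ [seq [:: (2 : int, inl i)] | i <- iota 0 n] ++
        [seq [:: (parity nodes c + 1, inr c)] | c <- r] ++
        [seq bracket_form r xs F c | c <- r] ++ [seq bracket_form r ys F c | c <- r] in
      let Z := eliminate_all eqs rounds in
      all (fun i => inl i \in Z) (iota 0 n) && all (fun c => inr c \in Z) r]].

Section Field.
Variables (K : closedFieldType) (charK0 : [pchar K] =i pred0).
Variable r : seq (seq int).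
Hypothesis rootsE : Defs.roots n edges =i r.
Hypothesis root_size : all (fun a => size a == n) r.

Local Notation V := (slaced_space n edges K).
Local Notation idx := (root_idx n edges).
Implicit Types u v : V.

Lemma sgn_parityE z : (-1 : K) ^ z = (sgn_parity z)%:~R.
Proof.
rewrite /sgn_parity; case: z => m; rewrite ?NegzE /=.
  by rewrite -exprnP -signr_odd; case: (odd m).
by rewrite -invr_expz -exprnP exprS -signr_odd; case: (odd m);
  rewrite /= ?mulr1 ?mulrNN ?mulr1 ?invr1 ?invrN1.
Qed.

Lemma idx_size (a : idx) : size (val a) = n.
Proof. by apply/eqP; move/allP: root_size; apply; rewrite -rootsE; apply: valP. Qed.

Definition coordinate v (t : nat + seq int) : K :=
  match t with
  | inl i => if insub i is Some j then v.1 0 j else 0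
  | inr a => if (insub a : option idx) is Some b then v.2 b else 0
  end.

Definition root_vec (xs : seq (int * seq int)) : V :=
  (0, [ffun c : idx => (fcoef xs (val c))%:~R]).

Definition form_vec (F : nat + seq int -> form (nat + seq int)%type) v : V :=
  (\row_i feval (coordinate v) (F (inl (i : nat))),
   [ffun c : idx => feval (coordinate v) (F (inr (val c)))]).

Lemma coordinate_linear t : linear (coordinate^~ t : V -> K^o).
Proof.
move=> c u v; case: t => [i|a] /=; case: (insub _) => [j|]; rewrite ?scaler0 ?addr0 //.
  by rewrite !mxE.
by rewrite !ffunE.
Qed.

Lemma form_vec_linear F : linear (form_vec F).
Proof.
have fl (k : K) u v f : feval (coordinate (k *: u + v)) f =
    k * feval (coordinate u) f + feval (coordinate v) f.
  rewrite /feval big_distrr -big_split /=; apply: eq_bigr => t _.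
  by rewrite coordinate_linear mulrDr mulrCA.
move=> k u v; congr (_, _).
  by apply/rowP => i; rewrite !mxE fl.
by apply/ffunP => a; rewrite !ffunE fl.
Qed.

Lemma feval_root_vec xs : {subset [seq t.2 | t <- xs] <= r} ->
  forall G : idx -> K, \sum_a (root_vec xs).2 a * G a =
    \sum_(t <- xs) t.1%:~R * (if insub t.2 is Some b then G b else 0).
Proof.
move=> sub G; elim: xs sub => [|t xs IHxs] sub.
  by rewrite big_nil big1 // => a _; rewrite ffunE mul0r.
rewrite big_cons -IHxs => [|a axs]; last by rewrite sub // inE axs orbT.
have tr : t.2 \in Defs.roots n edges by rewrite rootsE sub // inE eqxx.
rewrite insubT (bigD1 (Sub t.2 tr)) //= [X in _ = _ + X](bigD1 (Sub t.2 tr)) //=.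
rewrite !ffunE /= eqxx rmorphD mulrDl addrA; congr (_ + _).
apply: eq_bigr => a na; rewrite !ffunE /=; case: eqP => // ta.
by case/negP: na; apply/eqP/val_inj; rewrite /= ta.
Qed.

Lemma bracket_root_vec xs u (c : idx) : {subset [seq t.2 | t <- xs] <= r} ->
  (slaced_bracket (root_vec xs) u).2 c =
    \sum_(t <- xs) (t.1 * sgn_parity (euler t.2 (lat_sub (val c) t.2)))%:~R *
       coordinate u (inr (lat_sub (val c) t.2))
    - (fcoef xs (val c))%:~R * \sum_(i < n) (inner (simple_root n i) (val c))%:~R * u.1 0 i.
Proof.
move=> sub; rewrite /slaced_bracket !ffunE /= /cartan_pairing.
rewrite [X in X * _]big1 => [|i _]; last by rewrite mxE mul0r.
rewrite mul0r sub0r addrC; congr (_ - _); last first.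
  rewrite mulrC; congr (_ * _); apply: eq_bigr => i _.
  by rewrite innerE mulrC.
transitivity (\sum_a (root_vec xs).2 a *
    \sum_(b : idx | lat_add n (val a) (val b) == val c) asym n edges K (val a) (val b) * u.2 b).
  apply: eq_bigr => a _; rewrite big_distrr; apply: eq_bigr => b _ /=.
  by rewrite -mulrA mulrCA.
rewrite feval_root_vec //; apply: eq_big_seq => t txs; rewrite rmorphM -mulrA; congr (_ * _).
have tr : t.2 \in Defs.roots n edges by rewrite rootsE sub // map_f.
rewrite insubT /=.
under eq_bigl do rewrite lat_subP ?idx_size //.
case: insubP => [b br bE|nr].
  rewrite (big_pred1 b) => [|a]; last by rewrite -bE.
  by rewrite bE /asym sgn_parityE eulerE.
rewrite mulr0 big_pred0 // => a; apply: contraNF nr => /eqP <-; exact: valP.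
Qed.

Lemma fcoef_mem (T : eqType) (f : form T) t : t \notin [seq p.2 | p <- f] -> fcoef f t = 0.
Proof.
elim: f => //= p f IHf; rewrite inE negb_or => /andP[tp /IHf->].
by rewrite eq_sym (negPf tp).
Qed.

Lemma coordinate_root_vec xs a : {subset [seq t.2 | t <- xs] <= r} ->
  coordinate (root_vec xs) (inr a) = (fcoef xs a)%:~R.
Proof.
move=> sub /=; case: insubP => [b _ bE|na]; first by rewrite ffunE bE.
by rewrite fcoef_mem //; apply: contra na => /sub; rewrite rootsE.
Qed.

Lemma coordinate_form_vec F v a : coordinate (form_vec F v) (inr a) =
  if a \in r then feval (coordinate v) (F (inr a)) else 0.
Proof. by rewrite /= -rootsE; case: insubP => [b -> bE|/negPf->//]; rewrite ffunE bE. Qed.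

Lemma bracket_form_vec xs F v (c : idx) : {subset [seq t.2 | t <- xs] <= r} ->
  (slaced_bracket (root_vec xs) (form_vec F v)).2 c =
    feval (coordinate v) (bracket_form r xs F (val c)).
Proof.
move=> sub; rewrite bracket_root_vec // /bracket_form feval_cat feval_scale !feval_flatten.
rewrite rmorphN mulNr; congr (_ - _ * _).
  apply: eq_bigr => t _; rewrite coordinate_form_vec; case: ifP => _; rewrite ?feval_scale //.
  by rewrite mulr0 /feval big_nil.
set G := fun i : nat => feval (coordinate v) (fscale (inner (simple_root n i) (val c)) (F (inl i))).
transitivity (\sum_(i < n) G i).
  by apply: eq_bigr => i _; rewrite /G feval_scale mxE.
by rewrite -(big_mkord xpredT G) /index_iota subn0.
Qed.

Lemma parity_involutionE nodes (u : V) :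
  parity_involution nodes u = (u.1, [ffun c : idx => (parity nodes (val c))%:~R * u.2 c]).
Proof.
congr (_, _); apply/ffunP => c; rewrite !ffunE /parity -sgn_parityE; congr (_ ^ _ * _).
by rewrite sum_listE.
Qed.

End Field.

(** The criterion for rigidity is applied in the model; the list of roots is generalized first,
    so that no conversion depends on its value. *)
Lemma root_certificate_rigid (K : closedFieldType) (charK0 : [pchar K] =i pred0)
    (P : slaced_space n edges K -> Prop) nodes extra xs ys F rounds (S : symLieAlg K) :
  root_certificate nodes extra xs ys F rounds ->
  P (root_vec K xs) -> P (root_vec K ys) ->
  (forall v, P v -> P (form_vec F v)) ->
  (forall v, P v -> {in extra, forall f, feval (coordinate v) f = 0}) ->
  isomorphic_to S (PairModel P (@slaced_bracket n edges K) (@parity_involution n edges K nodes)) ->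
  has_nontrivial_rigid_pair S.
Proof.
move=> /and5P[rok /allP xr /allP yr /allP odd_xy] /and5P[xN0 /allP comm /allP opp /allP even_F].
move=> /andP[/allP elimh /allP elimr] Px Py PF Pextra iso.
have rE := mem_roots rok; have /and3P[_ rsize _] := rok.
move: (root_list) {rok} xr yr xN0 comm opp even_F elimh elimr rE rsize
  => r xr yr xN0 comm opp even_F elimh elimr rE rsize.
have oddv zs : {subset zs <= xs ++ ys} ->
    parity_involution nodes (root_vec K zs) = - root_vec K zs.
  move=> sub; rewrite parity_involutionE; congr (_, _); first by rewrite oppr0.
  apply/ffunP => c; rewrite !ffunE.
  have [/mapP[t tz ->]|/fcoef_mem->] := boolP (val c \in [seq t.2 | t <- zs]).
    by rewrite (eqP (odd_xy _ (sub _ tz))) mulN1r.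
  by rewrite mulr0 oppr0.
apply: (@model_criterion _ charK0 S
  (PairModel P (@slaced_bracket n edges K) (@parity_involution n edges K nodes))
  (root_vec K xs) (root_vec K ys) (form_vec F) iso) => //.
- exact: form_vec_linear.
- by apply: oddv => t tx; rewrite mem_cat tx.
- by apply: oddv => t ty; rewrite mem_cat ty orbT.
- rewrite /=; apply: (congr2 pair _ _ : _ = (0, 0)).
    apply/rowP => i; rewrite !mxE big1 ?oppr0 // => a _; rewrite big1 // => b.
    rewrite lat_subP ?(idx_size rE rsize) ?size_nseq // => /eqP bE; rewrite !ffunE bE.
    have [/mapP[t tx ->]|/fcoef_mem->] := boolP (val a \in [seq t.2 | t <- xs]).
      by rewrite (eqP (opp t tx)) mulr0 mul0r.
    by rewrite mul0r mul0r.
  apply/ffunP => c; rewrite (bracket_root_vec rE rsize) //.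
  rewrite [X in _ * X]big1 => [|i _]; last by rewrite mxE mulr0.
  rewrite mulr0 subr0 ffunE.
  have /comm/eqP : val c \in r by rewrite -rE; apply: valP.
  rewrite -sum_listE => /(congr1 (fun z : int => z%:~R : K)); rewrite rmorph_sum rmorph0 => sum0.
  rewrite -[RHS]sum0; apply: eq_bigr => t _.
  by rewrite (coordinate_root_vec K rE) // [RHS]rmorphM.
- apply: contraTneq xN0 => x0; apply/hasPn => a ar; rewrite negbK.
  have := coordinate_root_vec K rE a (xs := xs) xr; rewrite x0 /=.
  by case: insub => [b|]; rewrite ?ffunE => /esym/eqP; rewrite intr_char0.
move=> v Pv vodd; split; first exact: PF.
  rewrite /= parity_involutionE; congr (_, _); apply/ffunP => c; rewrite !ffunE.
  have /even_F/orP[/eqP->|/feval_fzero->] : val c \in r by rewrite -rE; apply: valP.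
    by rewrite mul1r.
  by rewrite mulr0.
move=> /= Xv Yv.
have : {in eliminate_all (extra ++ [seq [:: (2 : int, inl i)] | i <- iota 0 n] ++
        [seq [:: (parity nodes c + 1, inr c)] | c <- r] ++
        [seq bracket_form r xs F c | c <- r] ++
        [seq bracket_form r ys F c | c <- r]) rounds,
    forall t, coordinate v t = 0}.
  apply: eliminate_all_sound => // f.
  have bracket0 zs : {subset [seq t.2 | t <- zs] <= r} ->
      slaced_bracket (root_vec K zs) (form_vec F v) = 0 ->
      f \in [seq bracket_form r zs F c | c <- r] -> feval (coordinate v) f = 0.
    move=> sub zv /mapP[c cr ->]; have cr' : c \in Defs.roots n edges by rewrite rE.
    by rewrite -[c]/(val (Sub c cr' : root_idx n edges)) -(bracket_form_vec rE rsize) // zv ffunE.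
  move: vodd; rewrite /= parity_involutionE => -[vodd1 /ffunP vodd2].
  rewrite !mem_cat => /or4P[/Pextra|/mapP[i _ ->]|/mapP[c cr ->]|/orP[]].
  - exact.
  - rewrite /feval big_seq1 /=; case: insub => [j|]; last by rewrite mulr0.
    have /rowP/(_ j) := vodd1; rewrite mxE => vj.
    by rewrite [2%:~R](_ : _ = 1 + 1) // mulrDl !mul1r {1}vj addNr.
  - have cr' : c \in Defs.roots n edges by rewrite rE.
    rewrite /feval big_seq1 /= insubT; have := vodd2 (Sub c cr'); rewrite !ffunE /= => vc.
    by rewrite rmorphD mulrDl mul1r vc addNr.
  - exact: bracket0.
  - exact: bracket0.
move=> v0; have v1 : v.1 = 0.
  apply/rowP => i; have /elimh/v0 : (i : nat) \in iota 0 n by rewrite mem_iota add0n ltn_ord.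
  by rewrite /= valK mxE.
have v2 : v.2 = 0.
  apply/ffunP => c; have /elimr/v0 : val c \in r by rewrite -rE; apply: valP.
  by rewrite /= valK ffunE.
by rewrite [v]surjective_pairing v1 v2.
Qed.

End RootCertificate.

(** * Certificates for fixed points of diagram automorphisms *)

Section DiagramAutomorphism.
Variables (n : nat) (edges : seq (nat * nat)) (sigma : nat -> nat).

Definition sigma_root (a : seq int) : seq int := mkseq (fun i => a`_(sigma i)) n.
Definition sigma_coord (t : nat + seq int) : nat + seq int :=
  match t with inl i => inl (sigma i) | inr a => inr (sigma_root a) end.

Definition fixed_forms : seq (form (nat + seq int)%type) :=
  [seq [:: (1 : int, sigma_coord t); (-1, t)] |
    t <- [seq inl i | i <- iota 0 n] ++ [seq inr a | a <- root_list n edges]].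

Definition automorphism_certificate (xs ys : seq (int * seq int))
    (F : nat + seq int -> form (nat + seq int)%type) : bool :=
  let r := root_list n edges in
  [&& root_list_ok n edges r && all (fun a => sigma_root a \in r) r,
      all (fun i => sigma i < n)%N (iota 0 n),
      all (fun a => fcoef xs (sigma_root a) == fcoef xs a) r &
  [&& all (fun a => fcoef ys (sigma_root a) == fcoef ys a) r,
      all (fun i => fzero (F (inl (sigma i)) ++ fscale (-1) (F (inl i)))) (iota 0 n) &
      all (fun a => fzero (F (inr (sigma_root a)) ++ fscale (-1) (F (inr a)))) r]].

Definition sigma_fixed (K : fieldType) (u : slaced_space n edges K) : Prop :=
  (forall i j : 'I_n, j = sigma i :> nat -> u.1 0 j = u.1 0 i) /\
  (forall a b : root_idx n edges,
     val b = mkseq (fun i => (val a)`_(sigma i)) n -> u.2 b = u.2 a).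

Lemma fixed_root_certificate_rigid (K : closedFieldType) (charK0 : [pchar K] =i pred0)
    nodes xs ys F rounds (S : symLieAlg K) :
  root_certificate n edges nodes fixed_forms xs ys F rounds ->
  automorphism_certificate xs ys F ->
  isomorphic_to S (PairModel (@sigma_fixed K) (@slaced_bracket n edges K)
    (@parity_involution n edges K nodes)) ->
  has_nontrivial_rigid_pair S.
Proof.
move=> cert /and4P[/andP[rok /allP s_in] /allP s_n /allP sx /and3P[/allP sy /allP sh /allP sr]].
have rE := mem_roots rok.
have fixedE : fixed_forms = [seq [:: (1 : int, sigma_coord t); (-1, t)] |
  t <- [seq inl i | i <- iota 0 n] ++ [seq inr a | a <- root_list n edges]] by [].
move: (root_list n edges) {rok} s_in sx sy sr rE fixedE => r s_in sx sy sr rE fixedE.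
have mem_idx (a : root_idx n edges) : val a \in r by rewrite -rE; exact: (valP a).
have mem_ord (i : 'I_n) : (i : nat) \in iota 0 n by rewrite mem_iota add0n ltn_ord.
have fixed_root_vec zs : {in r, forall a, fcoef zs (sigma_root a) == fcoef zs a} ->
    sigma_fixed (root_vec n edges K zs).
  move=> zsE; split=> [i j _|a b ab]; first by rewrite !mxE.
  by rewrite !ffunE; congr (_%:~R); rewrite ab; apply/eqP/zsE.
apply: (root_certificate_rigid charK0 cert).
- exact: fixed_root_vec.
- exact: fixed_root_vec.
- move=> v _; split=> [i j ji|a b ab].
    rewrite !mxE ji; have /(feval_fzero (coordinate v)) := sh _ (mem_ord i).
    by rewrite feval_cat feval_scale mulN1r => /eqP; rewrite subr_eq0 => /eqP.
  rewrite !ffunE ab; have /(feval_fzero (coordinate v)) := sr _ (mem_idx a).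
  by rewrite feval_cat feval_scale mulN1r => /eqP; rewrite subr_eq0 => /eqP.
move=> v [vh vr] f; rewrite fixedE => /mapP[t]; rewrite mem_cat => /orP[] /mapP[i].
  rewrite mem_iota add0n => /andP[_ i_n] -> ->.
  have s_i : (sigma i < n)%N by apply: s_n; rewrite mem_iota.
  have := vh (Ordinal i_n) (Ordinal s_i) erefl.
  rewrite /feval big_cons big_seq1 mul1r mulN1r /= !insubT /= => ->.
  exact: subrr.
move=> ir -> ->; have ir' : i \in Defs.roots n edges by rewrite rE.
have sr' : sigma_root i \in Defs.roots n edges by rewrite rE s_in.
have := vr (SeqSub ir') (SeqSub sr') erefl.
rewrite /feval big_cons big_seq1 mul1r mulN1r /= !insubT /= => ->.
exact: subrr.
Qed.

End DiagramAutomorphism.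

(** * The pairs in e(7) and f(4) *)

Definition table_lookup (tab : seq ((nat + seq int) * (int * (nat + seq int)))) (t :
  nat + seq int) :
  form (nat + seq int)%type := [seq p.2 | p <- tab & p.1 == t].

(** The six roots of x and y generate a subsystem of type A5. In the corresponding sl(6), acting
    on K[s, t] / (s, t)^3, x and y are the multiplications by s and t, each being a sum of three
    matrix units; the sign in y makes them commute. *)
Definition EVII_x : seq (int * seq int) :=
  [:: (1, [:: 1; 1; 1; 1; 1; 1; 1]); (1, [:: 0; -1; -1; -1; -1; -1; -1]);
      (1, [:: 0; 0; 0; 1; 1; 1; 1])].
Definition EVII_y : seq (int * seq int) :=
  [:: (1, [:: 0; 0; 0; 0; 1; 1; 1]); (-1, [:: 0; -1; -1; -2; -1; -1; -1]);
      (1, [:: 1; 1; 2; 3; 2; 2; 1])].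
(** The roots of e(6) whose root vectors are not used by F; together with two toral directions,
    their number is the dimension 79 - 54 = 25 of the centralizer of the pair. *)
Definition EVII_free_roots : seq (seq int) :=
  [:: [:: 1; 0; 0; 0; 0; 0; 0]; [:: 0; 0; 0; 0; 0; 1; 0]; [:: 0; -1; 0; -1; -1; 0; 0];
      [:: 0; 0; -1; -1; -1; 0; 0]; [:: 0; -1; 0; -1; 0; 0; 0]; [:: 0; -1; -1; -1; 0; 0; 0];
      [:: 0; 0; -1; 0; 0; 0; 0]; [:: 0; -1; -1; -1; -1; 0; 0]; [:: 0; -1; -1; -2; -1; 0; 0];
      [:: 0; -1; -1; -1; -1; -1; 0]; [:: 0; -1; 0; -1; -1; -1; 0]; [:: 0; -1; -1; -2; -2; -1; 0];
      [:: -1; -1; -2; -2; -1; 0; 0]; [:: -1; -2; -2; -3; -2; -1; 0]; [:: 0; 0; 0; 0; 1; 1; 0];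
      [:: 0; 1; 0; 1; 1; 1; 0]; [:: 1; 0; 1; 1; 1; 0; 0]; [:: 1; 0; 1; 1; 1; 1; 0];
      [:: 1; 1; 1; 2; 2; 1; 0]; [:: 1; 1; 1; 2; 1; 1; 0]; [:: 1; 0; 1; 1; 0; 0; 0];
      [:: 0; -1; 0; 0; 0; 0; 0]; [:: 1; 1; 1; 1; 1; 1; 0]].
Definition EVII_table : seq ((nat + seq int) * (int * (nat + seq int))) :=
  let r := root_list 7 E7_edges in
  [seq (t.1, (1 : int, inr t.2)) |
    t <- zip ([seq inl i | i <- [:: 0; 1; 2; 3; 5]%N] ++
              [seq inr a | a <- r & (a`_6 == 0) && (a \notin EVII_free_roots)])
             [seq a <- r | a`_6 != 0]].

Lemma EVII_certificate :
  root_certificate 7 E7_edges [:: 6%N] [::] EVII_x EVII_y (table_lookup EVII_table) 10.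
Proof. by vm_compute. Qed.

(** Folding sends the two roots of x, and those of y, to a short root of f(4). The roots are odd
    and their sums are not roots, hence x and y commute. *)
Definition FII_x : seq (int * seq int) :=
  [:: (1, [:: 0; 0; 0; 0; 0; 1]); (1, [:: 1; 0; 0; 0; 0; 0])].
Definition FII_y : seq (int * seq int) :=
  [:: (1, [:: 0; 0; 0; 0; 1; 1]); (1, [:: 1; 0; 1; 0; 0; 0])].
Definition FII_positions : seq (nat + seq int) :=
  [:: inl 0%N; inl 3%N] ++ [seq inr a | a <-
    [:: [:: 0; 0; 0; 1; 0; 0]; [:: 0; 0; 0; 0; 1; 0]; [:: 0; 0; -1; 0; 0; 0];
        [:: -1; -1; -1; -1; -1; -1]; [:: -1; -1; -1; -2; -1; -1]; [:: -1; -1; -2; -2; -2; -1];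
        [:: -1; -1; -2; -2; -1; -1]; [:: -1; 0; -1; -1; -1; -1]; [:: 0; 0; 0; 1; 1; 0];
        [:: 0; 1; 0; 1; 1; 0]; [:: 0; 0; 1; 1; 1; 0]; [:: 0; 1; 1; 1; 1; 0];
        [:: 0; 1; 0; 1; 0; 0]; [:: 0; 1; 1; 2; 1; 0]]].
Definition FII_coordinates : seq (nat + seq int) :=
  [seq inr a | a <- root_list 6 E6_edges & (a`_0 == 0) && (a`_5 != 0)].
(** Half of F, completed by the automorphism; the positions that it fixes occur in both halves.
    *)
Definition FII_table : seq ((nat + seq int) * (int * (nat + seq int))) :=
  let half := [seq (t.1, (1 : int, t.2)) | t <- zip FII_positions FII_coordinates] in
  undup (half ++ [seq (sigma_coord 6 E6_flip t.1, t.2) | t <- half]).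
Lemma FII_certificate :
  root_certificate 6 E6_edges [:: 0; 5]%N (fixed_forms 6 E6_edges E6_flip) FII_x FII_y
    (table_lookup FII_table) 10.
Proof. by vm_compute. Qed.

Lemma FII_automorphism_certificate :
  automorphism_certificate 6 E6_edges E6_flip FII_x FII_y (table_lookup FII_table).
Proof. by vm_compute. Qed.

Section Exceptional.
Variables (K : closedFieldType) (charK0 : [pchar K] =i pred0).

Lemma EVII_rigid (S : symLieAlg K) : isomorphic_to S (EVII K) -> has_nontrivial_rigid_pair S.
Proof. by apply: (root_certificate_rigid charK0 EVII_certificate). Qed.

Lemma FII_rigid (S : symLieAlg K) : isomorphic_to S (FII K) -> has_nontrivial_rigid_pair S.
Proof. exact: fixed_root_certificate_rigid FII_certificate FII_automorphism_certificate. Qed.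

End Exceptional.

Theorem proposition3p3p1 (K : closedFieldType) (charK0 : [pchar K] =i pred0) :
  (forall p : nat, (2 <= p)%N ->
     forall S : symLieAlg K, isomorphic_to S (AIII K p 1) ->
       has_nontrivial_rigid_pair S) /\
  (forall p : nat, (2 <= p)%N ->
     forall S : symLieAlg K, isomorphic_to S (CII K p 1) ->
       has_nontrivial_rigid_pair S) /\
  (forall S : symLieAlg K, isomorphic_to S (CII K 3 3) ->
     has_nontrivial_rigid_pair S) /\
  (forall S : symLieAlg K, isomorphic_to S (DIII K 6) ->
     has_nontrivial_rigid_pair S) /\
  (forall S : symLieAlg K, isomorphic_to S (EVII K) ->
     has_nontrivial_rigid_pair S) /\
  (forall S : symLieAlg K, isomorphic_to S (FII K) ->
     has_nontrivial_rigid_pair S).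
Proof.
split=> [p p2 S|]; first exact: AIII_rigid.
split=> [p p2 S|]; first exact: CII_1_rigid.
split=> [S|]; first exact: CII_3_rigid.
split=> [S|]; first exact: DIII_6_rigid.
by split=> S; [exact: EVII_rigid|exact: FII_rigid].
Qed.
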